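(* Let $R=\bigoplus_{k\in\mathbb{Z}}R_k$ be a strongly $\mathbb{Z}$-graded ring and $P=\bigoplus_{k\ge0}R_k$. The localisation $\lambda\colon P\to\Omega_+^{-1}P$ is the universal $P$-ring making $R_0$-finitely dominated chain complexes contractible. That is: for every bounded complex $C^{+}$ of finitely generated free $P$-modules which is $R_0$-finitely dominated, $C^{+}\otimes_P\Omega_+^{-1}P$ is contractible; and if $f\colon P\to S$ is a ring homomorphism such that for every bounded complex $C^{+}$ of finitely generated free $P$-modules which is $R_0$-finitely dominated the complex $C^{+}\otimes_PS$ is contractible, then there is a factorisation $f=\eta\circ\lambda$, $P\xrightarrow{\lambda}\Omega_+^{-1}P\xrightarrow{\eta}S$, with a uniquely determined ring homomorphism $\eta$.
   Context: All rings are unital (possibly non-commutative), ring homomorphisms preserve $1$, modules are right modules. A $P$-ring is a ring homomorphism with domain $P$. A $\mathbb{Z}$-graded ring $R$ is strongly graded if the multiplication map $R_n\otimes_{R_0}R_{-n}\to R_0$ is surjective for every $n\in\mathbb{Z}$. For $m\in\mathbb{Z}$ put $t^{-m}P=\bigoplus_{k\ge-m}R_k\subseteq R$, a $P$-bimodule (finitely generated projective as a right $P$-module when $R$ is strongly graded). A chain complex of $R_0$-modules (a complex of $P$-modules is regarded as one by restriction of scalars) is $R_0$-finitely dominated if it is a retract up to chain homotopy of a bounded complex of finitely generated free $R_0$-modules. Let $R_*((t^{-1}))$ be the ring of formal Laurent series $\sum_{k\le p}r_kt^k$ ($p\in\mathbb{Z}$) with $r_k\in R_k$ for all $k$ ($t$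 central); $R$ is the subring of finite sums (identify $r\in R_k$ with $rt^k$). $\Omega_+$ is the set of all square matrices $A$ (of arbitrary finite size) with entries in $R$ that are invertible as matrices over $R_*((t^{-1}))$. For $A\in\Omega_+$ of size $k$ call $m\in\mathbb{Z}$ suitable if all entries of $A$ lie in $t^{-m}P$; then $\mu(A,m)\colon P^k\to(t^{-m}P)^k$, $x\mapsto A\cdot x$, is a homomorphism of right $P$-modules. Non-commutative localisation: for a ring $K$ and a set $\Sigma$ of homomorphisms of finitely generated projective right $K$-modules, $K\to\Sigma^{-1}K$ is the initial ring homomorphism with domain $K$ such that $\sigma\otimes_K\Sigma^{-1}K$ is an isomorphism for all $\sigma\in\Sigma$. $\lambda\colon P\to\Omega_+^{-1}P$ denotes the localisation of $P$ inverting all the maps $\mu(A,m)$ ($A\in\Omega_+$, $m$ suitable for $A$). *)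

(* Defs.v *)
From HB Require Import structures.
From mathcomp Require Import all_boot all_order all_algebra.
From mathcomp Require Import boolp classical_sets cardinality fsbigop functions.
From mathcomp Require Import zify.

Set Implicit Arguments.
Unset Strict Implicit.
Unset Printing Implicit Defensive.

Import Order.TTheory GRing.Theory Num.Theory.
Local Open Scope ring_scope.

(* Rings are [pzRingType]s: unital, not necessarily commutative, and possibly
   zero (a localisation may well be the zero ring).

   A right [K]-module is a left module over the converse ring [K^c], that is, an
   [lmodType K^c]; for [a : K^c] and [x : M], the element [a *: x] is what is
   usually written [x a].  [(K^c)^o] is [K] as a right module over itself. *)

Record complex (K : pzRingType) := Complex {
  cobj :> int -> lmodType K^c;
  cdiff : forall n : int, {linear cobj (n + 1) -> cobj n};
  cdiffK : forall (n : int) (x : cobj (n + 1 + 1)), cdiff n (cdiff (n + 1) x) = 0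
}.

Definition fg_free_mod (K : pzRingType) (M : lmodType K^c) : Prop :=
  exists (n : nat) (phi : {linear {ffun 'I_n -> (K^c)^o} -> M}), bijective phi.

Definition fg_free (K : pzRingType) (C : complex K) : Prop :=
  forall n : int, fg_free_mod (C n).

Definition bounded (K : pzRingType) (C : complex K) : Prop :=
  exists N : nat, forall n : int, (N < `|n|)%N -> forall x : C n, x = 0.

Definition is_chain_map (K : pzRingType) (C D : complex K)
    (f : forall n : int, {linear C n -> D n}) : Prop :=
  forall (n : int) (x : C (n + 1)), f n (cdiff C n x) = cdiff D n (f (n + 1) x).

(* The degrees [n + 1], [n : int], exhaust all degrees. *)
Definition homotopic (K : pzRingType) (C D : complex K)
    (f g : forall n : int, {linear C n -> D n}) : Prop :=
  exists s : forall n : int, {linear C n -> D (n + 1)},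
    forall (n : int) (x : C (n + 1)),
      f (n + 1) x - g (n + 1) x =
        cdiff D (n + 1) (s (n + 1) x) + s n (cdiff C n x).

Definition contractible (K : pzRingType) (C : complex K) : Prop :=
  homotopic (fun n : int => idfun : {linear C n -> C n})
            (fun n : int => \0 : {linear C n -> C n}).

Definition finitely_dominated (K : pzRingType) (C : complex K) : Prop :=
  exists D : complex K, [/\ bounded D, fg_free D &
    exists (i : forall n : int, {linear C n -> D n})
           (r : forall n : int, {linear D n -> C n}),
      [/\ is_chain_map i, is_chain_map r &
          homotopic (fun n : int => r n \o i n : {linear C n -> C n})
                    (fun n : int => idfun : {linear C n -> C n})]].

Definition restr (K P : pzRingType) (h : {rmorphism K -> P})
  (M : lmodType P^c) : Type := M.

Section Restriction.
Variables (K P : pzRingType) (h : {rmorphism K -> P}).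

Section Module.
Variable M : lmodType P^c.

HB.instance Definition _ := GRing.Zmodule.on (restr h M).

Definition restr_scale (a : K^c) (x : restr h M) : restr h M :=
  (h a : P^c) *: (x : M).

Fact restr_scaleA a b x :
  restr_scale a (restr_scale b x) = restr_scale (a * b) x.
Proof.
by rewrite /restr_scale scalerA; congr (_ *: _); exact: esym (rmorphM h b a).
Qed.

Fact restr_scale1 : left_id 1 restr_scale.
Proof. by move=> x; rewrite /restr_scale rmorph1 scale1r. Qed.

Fact restr_scaleDr : right_distributive restr_scale +%R.
Proof. by move=> a x y; rewrite /restr_scale scalerDr. Qed.

Fact restr_scaleDl x : {morph restr_scale^~ x : a b / a + b}.
Proof. by move=> a b; rewrite /restr_scale rmorphD scalerDl. Qed.

HB.instance Definition _ := GRing.Zmodule_isLmodule.Build K^c (restr h M)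
  restr_scaleA restr_scale1 restr_scaleDr restr_scaleDl.
End Module.

Definition restr_map_fun (M N : lmodType P^c) (g : {linear M -> N})
  (x : restr h M) : restr h N := g x.

Fact restr_map_linear (M N : lmodType P^c) (g : {linear M -> N}) :
  linear (restr_map_fun g).
Proof. by move=> a x y; rewrite /restr_map_fun linearP. Qed.

HB.instance Definition _ (M N : lmodType P^c) (g : {linear M -> N}) :=
  GRing.isLinear.Build K^c (restr h M) (restr h N) *:%R (restr_map_fun g)
    (restr_map_linear g).

Definition restr_map (M N : lmodType P^c) (g : {linear M -> N}) :
  {linear restr h M -> restr h N} := restr_map_fun g.

Definition restr_complex (C : complex P) : complex K :=
  @Complex K (fun n => restr h (C n)) (fun n => restr_map (cdiff C n))
    (fun n => @cdiffK P C n).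
End Restriction.

(* A list of pairs stands for the sum of the pure tensors [x.1 (x) x.2]. *)
Inductive tens_rel (K S : pzRingType) (f : {rmorphism K -> S})
    (M : lmodType K^c) : seq (M * S) -> seq (M * S) -> Prop :=
| TensRefl u : tens_rel f u u
| TensSym u v : tens_rel f u v -> tens_rel f v u
| TensTrans u v w : tens_rel f u v -> tens_rel f v w -> tens_rel f u w
| TensCat u u' v v' :
    tens_rel f u u' -> tens_rel f v v' -> tens_rel f (u ++ v) (u' ++ v')
| TensSwap u v : tens_rel f (u ++ v) (v ++ u)
| TensZero s : tens_rel f [:: (0, s)] [::]
| TensAddl x y s : tens_rel f [:: (x + y, s)] [:: (x, s); (y, s)]
| TensAddr x s t : tens_rel f [:: (x, s + t)] [:: (x, s); (x, t)]
| TensBal (a : K) x s :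
    tens_rel f [:: ((a : K^c) *: x, s)] [:: (x, f a * s)].

Section TensorModule.
Variables (K S : pzRingType) (f : {rmorphism K -> S}) (M : lmodType K^c).

Definition tens_relb (u v : seq (M * S)) : bool := `[< tens_rel f u v >].

Fact tens_relb_refl : reflexive tens_relb.
Proof. by move=> u; apply/asboolP; exact: TensRefl. Qed.

Fact tens_relb_sym : symmetric tens_relb.
Proof. by move=> u v; apply/asboolP/asboolP; exact: TensSym. Qed.

Fact tens_relb_trans : transitive tens_relb.
Proof.
by move=> v u w /asboolP uv /asboolP vw; apply/asboolP; exact: TensTrans uv vw.
Qed.

Canonical tens_equiv :=
  EquivRel tens_relb tens_relb_refl tens_relb_sym tens_relb_trans.

Definition tensor : Type := {eq_quot tens_equiv}%qT.
HB.instance Definition _ := Choice.on tensor.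

Definition tens_sum (u : seq (M * S)) : tensor := (\pi_({eq_quot tens_equiv}) u)%qT.
Definition tens_repr (x : tensor) : seq (M * S) :=
  (repr (x : {eq_quot tens_equiv}))%qT.

Lemma tens_reprK x : tens_sum (tens_repr x) = x.
Proof. exact: reprK. Qed.

Lemma tens_sumP u v : tens_sum u = tens_sum v <-> tens_rel f u v.
Proof. by split=> [/eqmodP/asboolP //|uv]; apply/eqmodP/asboolP. Qed.

Lemma tens_repr_rel u : tens_rel f (tens_repr (tens_sum u)) u.
Proof. by apply/tens_sumP; rewrite tens_reprK. Qed.

Definition tens_zero : tensor := tens_sum [::].
Definition tens_add (x y : tensor) : tensor :=
  tens_sum (tens_repr x ++ tens_repr y).
Definition tens_opp (x : tensor) : tensor :=
  tens_sum [seq (- p.1, p.2) | p <- tens_repr x].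
Definition tens_scale (b : S^c) (x : tensor) : tensor :=
  tens_sum [seq (p.1, p.2 * (b : S)) | p <- tens_repr x].

Lemma tens_add_sum u v : tens_add (tens_sum u) (tens_sum v) = tens_sum (u ++ v).
Proof. by apply/tens_sumP/TensCat; exact: tens_repr_rel. Qed.

Lemma tens_rel_opp (u v : seq (M * S)) : tens_rel f u v ->
  tens_rel f [seq (- p.1, p.2) | p <- u] [seq (- p.1, p.2) | p <- v].
Proof.
elim=> {u v} /=.
- by move=> u; exact: TensRefl.
- by move=> u v _ ?; exact: TensSym.
- by move=> u v w _ h1 _ h2; exact: TensTrans h1 h2.
- by move=> u u' v v' _ ? _ ?; rewrite !map_cat; exact: TensCat.
- by move=> u v; rewrite !map_cat; exact: TensSwap.
- by move=> s; rewrite oppr0; exact: TensZero.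
- by move=> x y s; rewrite opprD; exact: TensAddl.
- by move=> x s t; exact: TensAddr.
- by move=> a x s; rewrite -scalerN; exact: TensBal.
Qed.

Lemma tens_rel_scale b (u v : seq (M * S)) : tens_rel f u v ->
  tens_rel f [seq (p.1, p.2 * b) | p <- u] [seq (p.1, p.2 * b) | p <- v].
Proof.
elim=> {u v} /=.
- by move=> u; exact: TensRefl.
- by move=> u v _ ?; exact: TensSym.
- by move=> u v w _ h1 _ h2; exact: TensTrans h1 h2.
- by move=> u u' v v' _ ? _ ?; rewrite !map_cat; exact: TensCat.
- by move=> u v; rewrite !map_cat; exact: TensSwap.
- by move=> s; exact: TensZero.
- by move=> x y s; exact: TensAddl.
- by move=> x s t; rewrite mulrDl; exact: TensAddr.
- by move=> a x s; rewrite -mulrA; exact: TensBal.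
Qed.

Lemma tens_opp_sum u :
  tens_opp (tens_sum u) = tens_sum [seq (- p.1, p.2) | p <- u].
Proof. by apply/tens_sumP/tens_rel_opp; exact: tens_repr_rel. Qed.

Lemma tens_scale_sum b u :
  tens_scale b (tens_sum u) = tens_sum [seq (p.1, p.2 * (b : S)) | p <- u].
Proof. by apply/tens_sumP/tens_rel_scale; exact: tens_repr_rel. Qed.

Fact tens_addA : associative tens_add.
Proof.
move=> x y z; rewrite -[x]tens_reprK -[y]tens_reprK -[z]tens_reprK.
by rewrite !tens_add_sum catA.
Qed.

Fact tens_addC : commutative tens_add.
Proof.
move=> x y; rewrite -[x]tens_reprK -[y]tens_reprK !tens_add_sum.
by apply/tens_sumP; exact: TensSwap.
Qed.

Fact tens_add0 : left_id tens_zero tens_add.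
Proof. by move=> x; rewrite -[x]tens_reprK tens_add_sum. Qed.

Fact tens_addN : left_inverse tens_zero tens_opp tens_add.
Proof.
move=> x; rewrite -[x]tens_reprK tens_opp_sum tens_add_sum.
apply/tens_sumP; elim: (tens_repr x) => [|[m s] u IHu]; first exact: TensRefl.
set v := [seq _ | p <- u] in IHu *.
apply: (TensTrans (TensSwap _ _ _)); rewrite /= -/v.
rewrite -[_ :: _]/(([:: (m, s)] ++ u) ++ ([:: (- m, s)] ++ v)).
apply: (@TensTrans _ _ _ _ _ ([:: (- m, s)] ++ v ++ [:: (m, s)] ++ u)).
  by rewrite [X in tens_rel _ _ X]catA; exact: TensSwap.
apply: (@TensTrans _ _ _ _ _ (([:: (m, s)] ++ [:: (- m, s)]) ++ (v ++ u))).
  rewrite !catA; apply: TensCat (TensRefl _ _).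
  by rewrite -!catA catA; apply: TensTrans (TensSwap _ _ _) _; rewrite catA;
    exact: TensRefl.
rewrite -[[::]]/([::] ++ [::]); apply: TensCat => //.
apply: TensTrans (TensSym (TensAddl f m (- m) s)) _.
by rewrite subrr; exact: TensZero.
Qed.

HB.instance Definition _ :=
  GRing.isZmodule.Build tensor tens_addA tens_addC tens_add0 tens_addN.

Fact tens_scaleA a b x : tens_scale a (tens_scale b x) = tens_scale (a * b) x.
Proof.
rewrite -[x]tens_reprK !tens_scale_sum -map_comp; congr tens_sum.
by apply: eq_map => p /=; rewrite -mulrA.
Qed.

Fact tens_scale1 : left_id 1 tens_scale.
Proof.
move=> x; rewrite -[x]tens_reprK tens_scale_sum; congr tens_sum.
by rewrite -[RHS]map_id; apply: eq_map => -[m s] /=; rewrite mulr1.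
Qed.

Fact tens_scaleDr : right_distributive tens_scale +%R.
Proof.
move=> a x y; rewrite -[x]tens_reprK -[y]tens_reprK.
by rewrite /GRing.add /= tens_add_sum !tens_scale_sum tens_add_sum map_cat.
Qed.

Fact tens_scaleDl x : {morph tens_scale^~ x : a b / a + b}.
Proof.
move=> a b; rewrite -[x]tens_reprK [in RHS]/GRing.add /=.
rewrite !tens_scale_sum tens_add_sum; apply/tens_sumP.
elim: (tens_repr x) => [|[m s] u IHu] /=; first exact: TensRefl.
set v := [seq _ | p <- u] in IHu *; set v1 := [seq _ | p <- u] in IHu *.
set v2 := [seq _ | p <- u] in IHu *; rewrite mulrDr.
rewrite -[_ :: _]/([:: (m, s * a + s * b)] ++ v).
apply: TensTrans (TensCat (TensAddr _ _ _ _) IHu) _.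
rewrite -[_ ++ _]/([:: (m, s * a)] ++ (([:: (m, s * b)] ++ v1) ++ v2)).
rewrite -[X in tens_rel _ _ X]/([:: (m, s * a)] ++ (v1 ++ [:: (m, s * b)] ++ v2)).
apply: TensCat (TensRefl _ _) _; rewrite catA.
by apply: TensCat (TensSwap _ _ _) (TensRefl _ _).
Qed.

HB.instance Definition _ := GRing.Zmodule_isLmodule.Build S^c tensor
  tens_scaleA tens_scale1 tens_scaleDr tens_scaleDl.
End TensorModule.

Section TensorMap.
Variables (K S : pzRingType) (f : {rmorphism K -> S}).

Definition tens_map_fun (M N : lmodType K^c) (g : {linear M -> N})
    (x : tensor f M) : tensor f N :=
  tens_sum f [seq (g p.1, p.2) | p <- tens_repr x].

Lemma tens_rel_map (M N : lmodType K^c) (g : {linear M -> N}) (u v : seq (M * S)) :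
  tens_rel f u v ->
  tens_rel f [seq (g p.1, p.2) | p <- u] [seq (g p.1, p.2) | p <- v].
Proof.
elim=> {u v} /=.
- by move=> u; exact: TensRefl.
- by move=> u v _ ?; exact: TensSym.
- by move=> u v w _ h1 _ h2; exact: TensTrans h1 h2.
- by move=> u u' v v' _ ? _ ?; rewrite !map_cat; exact: TensCat.
- by move=> u v; rewrite !map_cat; exact: TensSwap.
- by move=> s; rewrite linear0; exact: TensZero.
- by move=> x y s; rewrite linearD; exact: TensAddl.
- by move=> x s t; exact: TensAddr.
- by move=> a x s; rewrite linearZ; exact: TensBal.
Qed.

Lemma tens_map_sum (M N : lmodType K^c) (g : {linear M -> N}) u :
  tens_map_fun g (tens_sum f u) = tens_sum f [seq (g p.1, p.2) | p <- u].
Proof. by apply/tens_sumP/tens_rel_map; exact: tens_repr_rel. Qed.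

Fact tens_map_linear (M N : lmodType K^c) (g : {linear M -> N}) :
  linear (tens_map_fun g).
Proof.
move=> a x y; rewrite -[x]tens_reprK -[y]tens_reprK.
rewrite /GRing.add /GRing.scale /= tens_scale_sum tens_add_sum !tens_map_sum.
rewrite tens_scale_sum tens_add_sum map_cat -!map_comp.
by congr (tens_sum _ (_ ++ _)); apply: eq_map.
Qed.

HB.instance Definition _ (M N : lmodType K^c) (g : {linear M -> N}) :=
  GRing.isLinear.Build S^c (tensor f M) (tensor f N) *:%R (tens_map_fun g)
    (tens_map_linear g).

Definition tens_map (M N : lmodType K^c) (g : {linear M -> N}) :
  {linear tensor f M -> tensor f N} := tens_map_fun g.

Fact tens_complex_diffK (C : complex K) (n : int) x :
  tens_map (cdiff C n) (tens_map (cdiff C (n + 1)) x) = 0.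
Proof.
rewrite -[x]tens_reprK /tens_map /= !tens_map_sum -map_comp.
apply/tens_sumP; elim: (tens_repr x) => [|[m s] u IHu] /=.
  exact: TensRefl.
rewrite cdiffK -cat1s -[[::]]/([::] ++ [::]); apply: TensCat => //.
exact: TensZero.
Qed.

Definition tens_complex (C : complex K) : complex S :=
  @Complex S (fun n => tensor f (C n)) (fun n => tens_map (cdiff C n))
    (@tens_complex_diffK C).
End TensorMap.

Definition hom_class (K : pzRingType) : Type :=
  forall M N : lmodType K^c, {linear M -> N} -> Prop.

Definition inverting (K S : pzRingType) (Sigma : hom_class K)
    (f : {rmorphism K -> S}) : Prop :=
  forall (M N : lmodType K^c) (sigma : {linear M -> N}),
    Sigma M N sigma -> bijective (tens_map f sigma).

Definition is_localisation (K L : pzRingType) (Sigma : hom_class K)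
    (lambda : {rmorphism K -> L}) : Prop :=
  inverting Sigma lambda /\
  forall (S : pzRingType) (f : {rmorphism K -> S}), inverting Sigma f ->
    exists eta : {rmorphism L -> S},
      f =1 eta \o lambda /\
      forall eta' : {rmorphism L -> S}, f =1 eta' \o lambda -> eta' =1 eta.

Definition decomposes (R : pzRingType) (gr : int -> {pred R}) (x : R)
    (c : int -> R) : Prop :=
  [/\ forall k, c k \in gr k,
      finite_set [set k | c k != 0]%classic &
      x = \sum_(k \in [set: int]%classic) c k].

Record grading (R : pzRingType) := Grading {
  gr :> int -> {pred R};
  gr_zmod : forall k, zmod_closed (gr k);
  gr_one : 1 \in gr 0;
  gr_mul : forall i j x y, x \in gr i -> y \in gr j -> x * y \in gr (i + j);
  gr_decomp : forall x, exists! c : int -> R, decomposes gr x c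
}.

(* Surjectivity of the multiplication map [R_n (x)_(R_0) R_(-n) -> R_0]: the
   elements of the tensor product are the finite sums of pure tensors. *)
Definition strongly_graded (R : pzRingType) (G : grading R) : Prop :=
  forall (n : int) (z : R), z \in G 0 ->
    exists s : seq (R * R),
      [/\ forall p, p \in s -> p.1 \in G n /\ p.2 \in G (- n) &
          z = \sum_(p <- s) p.1 * p.2].

Section GradedRing.
Variables (R : pzRingType) (G : grading R).

Definition hcomp (x : R) (k : int) : R := projT1 (cid (gr_decomp G x)) k.

Lemma hcomp_decomposes x : decomposes G x (hcomp x).
Proof. by rewrite /hcomp; case: cid => c []. Qed.

Lemma hcomp_unique x c : decomposes G x c -> c = hcomp x.
Proof. by rewrite /hcomp; case: cid => /= c' [_ Uc'] /Uc'. Qed.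

Lemma gr0 k : 0 \in G k.
Proof. by have [] := gr_zmod G k. Qed.

Lemma grB k x y : x \in G k -> y \in G k -> x - y \in G k.
Proof. by have [_] := gr_zmod G k; apply. Qed.

Lemma grN k x : x \in G k -> - x \in G k.
Proof. by move=> xk; rewrite -sub0r grB ?gr0. Qed.

Lemma grD k x y : x \in G k -> y \in G k -> x + y \in G k.
Proof. by move=> xk yk; rewrite -[y]opprK grB ?grN. Qed.

Lemma gr_sum k (I : Type) (s : seq I) (F : I -> R) :
  (forall i, F i \in G k) -> \sum_(i <- s) F i \in G k.
Proof.
by move=> h; apply: (big_ind (fun x => x \in G k)) => // [|x y]; [exact: gr0|exact: grD].
Qed.

Lemma fsum_seq (s : seq int) (F : int -> R) :
  uniq s -> (forall k, k \notin s -> F k = 0) ->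
  \sum_(k \in [set: int]%classic) F k = \sum_(k <- s) F k.
Proof.
move=> us Fs; rewrite (fsbigE s) //; last by move=> k _; exact: Fs.
by apply: eq_bigl => k; rewrite in_setT.
Qed.

Lemma decomposesP x c : decomposes G x c <->
  (forall k, c k \in G k) /\
  exists s : seq int,
    [/\ uniq s, forall k, k \notin s -> c k = 0 & x = \sum_(k <- s) c k].
Proof.
split=> [[cG /finite_seqP [s sE] ->]|[cG [s [us cs ->]]]].
  have cs k : k \notin undup s -> c k = 0.
    rewrite mem_undup => ks; apply/eqP/negPn/negP => ck.
    have : [set` s]%classic k by rewrite -sE.
    by rewrite /= (negPf ks).
  split=> //; exists (undup s); split; rewrite ?undup_uniq //.
  by apply: fsum_seq => //; exact: undup_uniq.
split=> //; last by rewrite (fsum_seq us).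
apply: (@sub_finite_set _ _ [set` s]%classic); last by apply/finite_seqP; exists s.
by move=> k /= ck; apply/negPn/negP => /cs/eqP; rewrite (negPf ck).
Qed.

Lemma hcomp_gr x k : hcomp x k \in G k.
Proof. by case: (hcomp_decomposes x). Qed.

Lemma hcompB x y k : hcomp (x - y) k = hcomp x k - hcomp y k.
Proof.
rewrite -(@hcomp_unique (x - y) (fun k => hcomp x k - hcomp y k)) //.
apply/decomposesP; split=> [i|]; first by rewrite grB ?hcomp_gr.
have /decomposesP[_ [s [us hs xE]]] := hcomp_decomposes x.
have /decomposesP[_ [t [ut ht yE]]] := hcomp_decomposes y.
have hst k' : k' \notin undup (s ++ t) -> hcomp x k' = 0 /\ hcomp y k' = 0.
  by rewrite mem_undup mem_cat negb_or => /andP[/hs-> /ht->].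
exists (undup (s ++ t)); split=> [|i /hst[-> ->]|]; first exact: undup_uniq.
  by rewrite subrr.
rewrite {1}xE {1}yE sumrB -(fsum_seq us hs) -(fsum_seq ut ht).
by congr (_ - _); apply: fsum_seq; rewrite ?undup_uniq // => i /hst[].
Qed.

Lemma hcomp_homog k x : x \in G k -> hcomp x = fun i => if i == k then x else 0.
Proof.
move=> xk; apply/esym/hcomp_unique/decomposesP; split=> [i|].
  by case: eqP => [->//|_]; exact: gr0.
exists [:: k]; split=> // [i|]; first by rewrite inE => /negPf->.
by rewrite big_seq1 eqxx.
Qed.

Lemma hcomp0 k : hcomp 0 k = 0.
Proof. by rewrite (hcomp_homog (gr0 0)); case: eqP. Qed.

Lemma hcompN x k : hcomp (- x) k = - hcomp x k.
Proof. by rewrite -sub0r hcompB hcomp0 sub0r. Qed.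

Lemma hcompD x y k : hcomp (x + y) k = hcomp x k + hcomp y k.
Proof. by rewrite -[y in LHS]opprK hcompB hcompN opprK. Qed.

Lemma hcomp_sum (I : Type) (s : seq I) (F : I -> R) k :
  hcomp (\sum_(i <- s) F i) k = \sum_(i <- s) hcomp (F i) k.
Proof.
by elim/big_rec2: _ => [|i y z _ IH]; rewrite ?hcomp0 // hcompD IH.
Qed.

Lemma hcomp_sumE x : exists s : seq int, x = \sum_(k <- s) hcomp x k.
Proof. by have /decomposesP[_ [s [_ _ ?]]] := hcomp_decomposes x; exists s. Qed.

(* [t^-m P], the direct sum of the [R_k] with [k >= -m]. *)
Definition tpow_pred (m : int) : {pred R} :=
  fun x => `[< forall k, k < - m -> hcomp x k = 0 >].

Lemma tpow_predP m x :
  reflect (forall k, k < - m -> hcomp x k = 0) (x \in tpow_pred m).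
Proof. exact: asboolP. Qed.

Lemma tpow_zmod m : zmod_closed (tpow_pred m).
Proof.
split=> [|x y /tpow_predP xm /tpow_predP ym]; apply/tpow_predP => k km.
  exact: hcomp0.
by rewrite hcompB xm // ym // subrr.
Qed.

Lemma tpow_mul m n x y :
  x \in tpow_pred m -> y \in tpow_pred n -> x * y \in tpow_pred (m + n).
Proof.
move=> /tpow_predP xm /tpow_predP yn; apply/tpow_predP => k km.
have [s ->] := hcomp_sumE x; have [t ->] := hcomp_sumE y.
rewrite mulr_suml hcomp_sum big1_seq // => i _.
rewrite mulr_sumr hcomp_sum big1_seq // => j _.
rewrite (hcomp_homog (gr_mul (hcomp_gr x i) (hcomp_gr y j))).
case: eqP => // kij; have [im|im] := ltP i (- m); first by rewrite xm // mul0r.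
by rewrite yn ?mulr0 //; lia.
Qed.

Lemma tpow_one : 1 \in tpow_pred 0.
Proof.
apply/tpow_predP => k k0; rewrite (hcomp_homog (gr_one G)).
by case: eqP => // k0'; lia.
Qed.

Definition pos_pred : {pred R} := tpow_pred 0.

Fact pos_subring : subring_closed pos_pred.
Proof.
split=> [|x y|x y]; first exact: tpow_one.
  by have [_] := tpow_zmod 0; apply.
exact: (@tpow_mul 0 0).
Qed.

Record pos_ring := PosRing { pos_val : R; _ : pos_val \in pos_pred }.
HB.instance Definition _ := [isSub for pos_val].
HB.instance Definition _ := [Choice of pos_ring by <:].
HB.instance Definition _ :=
  GRing.SubChoice_isSubPzRing.Build R pos_pred pos_ring pos_subring.

Definition zero_pred : {pred R} := G 0.

Fact zero_subring : subring_closed zero_pred.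
Proof.
split=> [|x y|x y]; [exact: gr_one | exact: grB |].
by move=> x0 y0; have := gr_mul x0 y0; rewrite addr0.
Qed.

Record zero_ring := ZeroRing { zero_val : R; _ : zero_val \in zero_pred }.
HB.instance Definition _ := [isSub for zero_val].
HB.instance Definition _ := [Choice of zero_ring by <:].
HB.instance Definition _ :=
  GRing.SubChoice_isSubPzRing.Build R zero_pred zero_ring zero_subring.

Fact zero_in_pos (x : zero_ring) : zero_val x \in pos_pred.
Proof.
apply/tpow_predP => k k0; rewrite (hcomp_homog (valP x)).
by case: eqP => // k0'; lia.
Qed.

Definition zero_to_pos (x : zero_ring) : pos_ring := PosRing (zero_in_pos x).

Fact zero_to_pos_zmod : zmod_morphism zero_to_pos.
Proof. by move=> x y; apply: val_inj. Qed.

Fact zero_to_pos_monoid : monoid_morphism zero_to_pos.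
Proof. by split=> [|x y]; apply: val_inj. Qed.

HB.instance Definition _ :=
  GRing.isZmodMorphism.Build zero_ring pos_ring zero_to_pos zero_to_pos_zmod.
HB.instance Definition _ :=
  GRing.isMonoidMorphism.Build zero_ring pos_ring zero_to_pos zero_to_pos_monoid.

Record tpow (m : int) := TPow { tpow_val : R; _ : tpow_val \in tpow_pred m }.
HB.instance Definition _ m := [isSub for @tpow_val m].
HB.instance Definition _ m := [Choice of tpow m by <:].
HB.instance Definition _ m :=
  GRing.SubChoice_isSubZmodule.Build R (tpow_pred m) (tpow m) (tpow_zmod m).

Fact tpow_scale_subproof m (a : pos_ring) (x : tpow m) :
  tpow_val x * pos_val a \in tpow_pred m.
Proof. by have := tpow_mul (valP x) (valP a); rewrite addr0. Qed.

Definition tpow_scale m (a : pos_ring^c) (x : tpow m) : tpow m :=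
  TPow (tpow_scale_subproof a x).

Fact tpow_scaleA m a b (x : tpow m) :
  tpow_scale a (tpow_scale b x) = tpow_scale (a * b) x.
Proof. by apply: val_inj; rewrite /= -mulrA. Qed.

Fact tpow_scale1 m : left_id 1 (@tpow_scale m).
Proof. by move=> x; apply: val_inj; rewrite /= mulr1. Qed.

Fact tpow_scaleDr m : right_distributive (@tpow_scale m) +%R.
Proof. by move=> a x y; apply: val_inj; rewrite /= mulrDl. Qed.

Fact tpow_scaleDl m x : {morph (@tpow_scale m)^~ x : a b / a + b}.
Proof. by move=> a b; apply: val_inj; rewrite /= mulrDr. Qed.

HB.instance Definition _ m := GRing.Zmodule_isLmodule.Build pos_ring^c (tpow m)
  (@tpow_scaleA m) (@tpow_scale1 m) (@tpow_scaleDr m) (@tpow_scaleDl m).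

(* [a : int -> R] stands for the formal series with terms [a k * t^k]. *)
Definition laurent_pred : {pred int -> R} :=
  fun a => `[< (forall k, a k \in G k) /\
               exists p : int, forall k, p < k -> a k = 0 >].

Lemma laurent_predP a :
  reflect ((forall k, a k \in G k) /\ exists p : int, forall k, p < k -> a k = 0)
          (a \in laurent_pred).
Proof. exact: asboolP. Qed.

Fact laurent_zmod : zmod_closed laurent_pred.
Proof.
split=> [|a b /laurent_predP[aG [p ap]] /laurent_predP[bG [q bq]]];
  apply/laurent_predP.
  by split=> [k|]; [exact: gr0 | exists 0].
split=> [k|]; first by rewrite /GRing.add /GRing.opp /=; exact: grB.
exists (Num.max p q) => k; rewrite gt_max => /andP[pk qk].
by rewrite /GRing.add /GRing.opp /= ap // bq // subr0.
Qed.

Record laurent := Laurent { lcoef :> int -> R; _ : lcoef \in laurent_pred }.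
HB.instance Definition _ := [isSub for lcoef].
HB.instance Definition _ := [Choice of laurent by <:].
HB.instance Definition _ :=
  GRing.SubChoice_isSubZmodule.Build (int -> R) laurent_pred laurent laurent_zmod.

Lemma laurent_gr (a : laurent) k : a k \in G k.
Proof. by have /laurent_predP[] := valP a. Qed.

Lemma laurent_ub (a : laurent) : exists p : int, forall k, p < k -> a k = 0.
Proof. by have /laurent_predP[] := valP a. Qed.

Lemma lcoefD (a b : laurent) k : (a + b) k = a k + b k.
Proof. by []. Qed.

Definition conv (a b : int -> R) (n : int) : R :=
  \sum_(i \in [set: int]%classic) a i * b (n - i).

Definition irange (a b : int) : seq int :=
  [seq a + i%:Z | i <- iota 0 (absz (b - a + 1))].

Lemma irange_uniq a b : uniq (irange a b).
Proof. by rewrite map_inj_uniq ?iota_uniq // => i j /addrI[]. Qed.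

Lemma mem_irange a b k : a <= k -> k <= b -> k \in irange a b.
Proof.
move=> ak kb; apply/mapP; exists (absz (k - a)); last by lia.
by rewrite mem_iota; lia.
Qed.

Lemma notin_irange a b k : k \notin irange a b -> k < a \/ b < k.
Proof.
move=> kab; have [?|ak] := ltP k a; first by left.
by have [?|kb] := ltP b k; [right | rewrite mem_irange in kab].
Qed.

Lemma conv_shift (a b : int -> R) (n i lo hi : int) :
  (forall j, j + i < lo \/ hi < j + i -> a j * b (n - j) = 0) ->
  conv a b n = \sum_(k <- irange lo hi) a (k - i) * b (n + i - k).
Proof.
move=> h; rewrite /conv (@fsum_seq [seq k - i | k <- irange lo hi]).
- rewrite big_map; apply: eq_bigr => k _.
  by congr (_ * b _); lia.
- by rewrite map_inj_uniq ?irange_uniq // => x y /addIr.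
- move=> j hj; apply: h; apply: notin_irange; apply: contra hj => hj.
  by apply/mapP; exists (j + i); rewrite ?addrK.
Qed.

Lemma convE (a b : int -> R) (n lo hi : int) :
  (forall j, j < lo \/ hi < j -> a j * b (n - j) = 0) ->
  conv a b n = \sum_(k <- irange lo hi) a k * b (n - k).
Proof.
move=> h; rewrite (@conv_shift a b n 0 lo hi) => [|j]; last by rewrite addr0 => /h.
by apply: eq_bigr => k _; rewrite subr0 addr0.
Qed.

Lemma conv_range (a b : int -> R) (n p q : int) :
  (forall k, p < k -> a k = 0) -> (forall k, q < k -> b k = 0) ->
  conv a b n = \sum_(k <- irange (n - q) p) a k * b (n - k).
Proof.
move=> ap bq; apply: convE => j [jn|jp]; last by rewrite ap // mul0r.
by rewrite bq ?mulr0 //; lia.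
Qed.

Fact conv_laurent (a b : laurent) : conv a b \in laurent_pred.
Proof.
have [p ap] := laurent_ub a; have [q bq] := laurent_ub b.
apply/laurent_predP; split=> [n|].
  rewrite (conv_range _ ap bq); apply: gr_sum => i.
  by have := gr_mul (laurent_gr a i) (laurent_gr b (n - i)); rewrite [i + _]addrC subrK.
exists (p + q) => n pqn; rewrite (conv_range _ ap bq) big1_seq // => i _.
have [pi|ip] := ltP p i; first by rewrite ap // mul0r.
by rewrite bq ?mulr0 //; lia.
Qed.

Definition laurent_mul (a b : laurent) : laurent := Laurent (conv_laurent a b).

(* The inclusion of [R], identifying [r] in [R_k] with [r t^k]. *)
Fact laurent_of_subproof (x : R) : hcomp x \in laurent_pred.
Proof.
apply/laurent_predP; split=> [k|]; first exact: hcomp_gr.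
have /decomposesP[_ [s [_ hs _]]] := hcomp_decomposes x.
exists (\sum_(i <- s) `|i|) => k hk; apply: hs; apply/negP => ks.
suff : `|k| <= \sum_(i <- s) `|i| by lia.
rewrite (big_rem k) //= lerDl; exact: sumr_ge0.
Qed.

Definition laurent_of (x : R) : laurent := Laurent (laurent_of_subproof x).

Definition laurent_one : laurent := laurent_of 1.

Lemma hcomp1 k : hcomp 1 k = if k == 0 then 1 else 0.
Proof. by rewrite (hcomp_homog (gr_one G)). Qed.

Fact laurent_mulA : associative laurent_mul.
Proof.
move=> a b c; apply: val_inj; apply/funext => n /=.
have [p ap] := laurent_ub a; have [q bq] := laurent_ub b.
have [r cr] := laurent_ub c.
have abpq k : p + q < k -> conv a b k = 0.
  move=> pqk; rewrite (conv_range _ ap bq) big1_seq // => i _.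
  have [pi|ip] := ltP p i; first by rewrite ap // mul0r.
  by rewrite bq ?mulr0 //; lia.
rewrite (conv_range n abpq cr).
have lcoef_a i : i \in irange (n - r - q) p -> a i * conv b c (n - i) =
    \sum_(k <- irange (n - r) (p + q)) a i * b (k - i) * c (n - k).
  move=> _; have [pi|ip] := ltP p i.
    by rewrite ap // mul0r big1_seq // => k _; rewrite !mul0r.
  rewrite (@conv_shift b c (n - i) i (n - r) (p + q)) => [|j [jl|jh]].
  - by rewrite mulr_sumr; apply: eq_bigr => k _; rewrite subrK mulrA.
  - by rewrite cr ?mulr0 //; lia.
  - by rewrite bq ?mul0r //; lia.
rewrite (@convE a _ n (n - r - q) p) => [|j [jl|jh]]; last first.
- by rewrite ap // mul0r.
- rewrite (conv_range _ bq cr) big1_seq ?mulr0 // => k _.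
  have [qk|kq] := ltP q k; first by rewrite bq // mul0r.
  by rewrite cr ?mulr0 //; lia.
rewrite (eq_big_seq _ lcoef_a) exchange_big; apply: eq_big_seq => k _ /=.
rewrite -mulr_suml; have [kl|kl] := ltP k (n - r).
  by rewrite cr ?mulr0 //; lia.
congr (_ * _); apply/esym/convE => j [jl|jh]; last by rewrite ap // mul0r.
by rewrite bq ?mulr0 //; lia.
Qed.

Fact laurent_mul1l : left_id laurent_one laurent_mul.
Proof.
move=> a; apply: val_inj; apply/funext => n /=.
rewrite (@convE _ _ n 0 0) => [|j j0].
  by rewrite -[irange 0 0]/[:: 0] big_seq1 hcomp1 eqxx mul1r subr0.
by have /negPf j1 : j != 0; [lia | rewrite hcomp1 j1 mul0r].
Qed.

Fact laurent_mul1r : right_id laurent_one laurent_mul.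
Proof.
move=> a; apply: val_inj; apply/funext => n /=.
rewrite (@convE _ _ n n n) => [|j j0].
  have -> : irange n n = [:: n] by rewrite /irange subrr /= addr0.
  by rewrite big_seq1 subrr hcomp1 eqxx mulr1.
by have /negPf j1 : n - j != 0; [lia | rewrite hcomp1 j1 mulr0].
Qed.

Fact laurent_mulDl : left_distributive laurent_mul +%R.
Proof.
move=> a b c; apply: val_inj; apply/funext => n.
have [p ap] := laurent_ub a; have [q bq] := laurent_ub b.
have [r cr] := laurent_ub c.
have ap' k : Num.max p q < k -> a k = 0.
  by rewrite gt_max => /andP[/ap].
have bq' k : Num.max p q < k -> b k = 0.
  by rewrite gt_max => /andP[_ /bq].
have abpq' k : Num.max p q < k -> (a + b) k = 0.
  by move=> hk; rewrite lcoefD ap' // bq' // addr0.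
rewrite [LHS](conv_range _ abpq' cr) [RHS]lcoefD.
rewrite [X in _ = X + _](conv_range _ ap' cr) [X in _ = _ + X](conv_range _ bq' cr).
by rewrite -big_split; apply: eq_bigr => k _; rewrite lcoefD mulrDl.
Qed.

Fact laurent_mulDr : right_distributive laurent_mul +%R.
Proof.
move=> c a b; apply: val_inj; apply/funext => n.
have [p ap] := laurent_ub a; have [q bq] := laurent_ub b.
have [r cr] := laurent_ub c.
have ap' k : Num.max p q < k -> a k = 0.
  by rewrite gt_max => /andP[/ap].
have bq' k : Num.max p q < k -> b k = 0.
  by rewrite gt_max => /andP[_ /bq].
have abpq' k : Num.max p q < k -> (a + b) k = 0.
  by move=> hk; rewrite lcoefD ap' // bq' // addr0.
rewrite [LHS](conv_range _ cr abpq') [RHS]lcoefD.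
rewrite [X in _ = X + _](conv_range _ cr ap') [X in _ = _ + X](conv_range _ cr bq').
by rewrite -big_split; apply: eq_bigr => k _; rewrite lcoefD mulrDr.
Qed.

HB.instance Definition _ := GRing.Zmodule_isPzRing.Build laurent
  laurent_mulA laurent_mul1l laurent_mul1r laurent_mulDl laurent_mulDr.

(* [unitmx] is only available over commutative rings. *)
Definition Omega_plus (k : nat) (A : 'M[R]_k) : Prop :=
  exists B : 'M[laurent]_k,
    map_mx laurent_of A *m B = 1%:M /\ B *m map_mx laurent_of A = 1%:M.

Definition suitable (k : nat) (A : 'M[R]_k) (m : int) : Prop :=
  forall i j, A i j \in tpow_pred m.

Section Mu.
Variables (k : nat) (A : 'M[R]_k) (m : int) (Am : suitable A m).

(* [(x j : pos_ring^c) *: TPow (Am i j)] is the product [A i j * x j] in [R]. *)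
Definition mu_fun (x : {ffun 'I_k -> (pos_ring^c)^o}) : {ffun 'I_k -> tpow m} :=
  [ffun i => \sum_(j < k) (x j : pos_ring^c) *: TPow (Am i j)].

Lemma mu_funE x i :
  tpow_val (mu_fun x i) = \sum_(j < k) A i j * pos_val (x j).
Proof. by rewrite ffunE -[LHS]/(val _) raddf_sum. Qed.

Fact mu_linear : linear mu_fun.
Proof.
move=> a x y; apply/ffunP => i; rewrite !ffunE scaler_sumr -big_split /=.
by apply: eq_bigr => j _; rewrite !ffunE scalerDl scalerA.
Qed.

HB.instance Definition _ := GRing.isLinear.Build pos_ring^c
  {ffun 'I_k -> (pos_ring^c)^o} {ffun 'I_k -> tpow m} *:%R mu_fun mu_linear.

Definition mu : {linear {ffun 'I_k -> (pos_ring^c)^o} -> {ffun 'I_k -> tpow m}} :=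
  mu_fun.
End Mu.

Inductive Omega_plus_maps : hom_class pos_ring :=
| OmegaPlusMap (k : nat) (A : 'M[R]_k) (m : int) (Am : suitable A m) :
    Omega_plus A -> Omega_plus_maps (mu Am).

Definition makes_fd_contractible (S : pzRingType) (f : {rmorphism pos_ring -> S}) :
    Prop :=
  forall C : complex pos_ring, bounded C -> fg_free C ->
    finitely_dominated (restr_complex zero_to_pos C) ->
    contractible (tens_complex f C).
End GradedRing.

(* Main.v *)
Require Import Defs.
From HB Require Import structures.
From mathcomp Require Import all_boot all_order all_algebra.
From mathcomp Require Import boolp.
From mathcomp Require Import zify.

(** Localisation makes [R_0]-finitely dominated complexes contractible: let [C]
    be such a complex of free [P]-modules, with [R_0]-linear maps satisfying
    [x = d (h x) + h (d x) + g x], where [g] has image in bounded degrees.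
    Writing [1 = sum_j a_j b_j] with [a_j] in [R_N] and [b_j] in [R_-N], the
    conjugate [sum_j h (x a_j) b_j] of [h] by the shift [t^N] satisfies the same
    relation on [t^-N C], with an error term in degrees [<= q - N].  Extending
    its values on basis vectors [P]-linearly, one degree at a time, gives
    matrices [S] over [R] such that [1 - (D S + S D)] has negative degree for [N]
    large; then [D S + S D] is in [Omega_+], by the geometric series.  It defines
    a null-homotopic chain map [C -> t^-N C], which becomes an isomorphism over
    the localisation.

    Conversely, for [A] in [Omega_+] the map [mu A m] is split injective over
    [R_0], with retraction [y |-> (A^-1 y)_(>= 0)], and its cokernel lives in
    finitely many degrees, hence is finitely generated projective over [R_0].
    As [t^-m P] need not be stably free, the two-term complex [mu A m] is not a
    free complex up to homotopy; for [m >= 0] it is a direct summand of the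
    complex [P^k -> F + P^k -> F], with [F] free retracting onto [(t^-m P)^k],
    in which the shifted inclusion [mu 1 m] cancels the class of [t^-m P] in
    [K_0]. *)

Set Implicit Arguments.
Unset Strict Implicit.
Unset Printing Implicit Defensive.

Import Order.TTheory GRing.Theory Num.Theory.
Local Open Scope ring_scope.

(** * Degrees *)

Section Degrees.
Variables (R : pzRingType) (G : grading R).
Implicit Types (x y : R) (a b : laurent G).

Lemma laurent_ext a b : (forall k, a k = b k) -> a = b.
Proof. by move=> ab; apply/val_inj/funext. Qed.

(** An element is the sum of its components, and the coefficients of its series are exactly these
    components. *)
Lemma laurent_of_inj : injective (laurent_of G).
Proof.
move=> x y xy; apply/eqP; rewrite -subr_eq0; apply/eqP.
have [s ->] := hcomp_sumE G (x - y); apply: big1 => k _.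
by rewrite hcompB -[hcomp G x k]/(laurent_of G x k) xy subrr.
Qed.

Lemma hcomp_inj x y : (forall k, hcomp G x k = hcomp G y k) -> x = y.
Proof. by move=> xy; apply/laurent_of_inj/laurent_ext. Qed.

Fact laurent_of_zmod : zmod_morphism (laurent_of G).
Proof. by move=> x y; apply: laurent_ext => k; exact: hcompB. Qed.

HB.instance Definition _ :=
  GRing.isZmodMorphism.Build R (laurent G) (laurent_of G) laurent_of_zmod.

Lemma laurent_ofM_homog i j x y : x \in G i -> y \in G j ->
  laurent_of G (x * y) = laurent_of G x * laurent_of G y.
Proof.
move=> xi yj; apply: laurent_ext => n; rewrite [RHS](@convE _ _ _ _ i i) => [|k ki].
  rewrite /irange subrr /= big_seq1 addr0 /= (hcomp_homog (gr_mul xi yj)).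
  rewrite (hcomp_homog xi) eqxx (hcomp_homog yj) subr_eq addrC.
  by case: ifP; rewrite ?mulr0.
by rewrite /= (hcomp_homog xi); case: eqP => [|_]; [lia | rewrite mul0r].
Qed.

Fact laurent_of_monoid : monoid_morphism (laurent_of G).
Proof.
split=> // x y; have [s xE] := hcomp_sumE G x; have [t yE] := hcomp_sumE G y.
rewrite {1}xE {1}yE mulr_suml [in RHS]xE [in RHS]yE !raddf_sum mulr_suml.
apply: eq_bigr => i _; rewrite !mulr_sumr raddf_sum; apply: eq_bigr => j _.
exact: laurent_ofM_homog (hcomp_gr _ _ _) (hcomp_gr _ _ _).
Qed.

HB.instance Definition _ :=
  GRing.isMonoidMorphism.Build R (laurent G) (laurent_of G) laurent_of_monoid.

Definition ldeg_le (p : int) a : Prop := forall k, p < k -> a k = 0.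
(** Passing through [laurent_of] lets elements of [R] inherit the rules for sums and products of
    series. *)
Definition deg_le (p : int) x : Prop := ldeg_le p (laurent_of G x).

Lemma ldeg_leW p q a : p <= q -> ldeg_le p a -> ldeg_le q a.
Proof. by move=> pq ap k qk; apply: ap; lia. Qed.

Lemma ldeg_leD p a b : ldeg_le p a -> ldeg_le p b -> ldeg_le p (a + b).
Proof. by move=> ap bp k pk; rewrite lcoefD ap // bp // addr0. Qed.

Lemma ldeg_leN p a : ldeg_le p a -> ldeg_le p (- a).
Proof.
by move=> ap k pk; rewrite -[LHS]/(- (a k)) ap // oppr0.
Qed.

Lemma ldeg_le0 p : ldeg_le p 0.
Proof. by []. Qed.

Lemma ldeg_le_sum p (I : Type) (s : seq I) (F : I -> laurent G) :
  (forall i, ldeg_le p (F i)) -> ldeg_le p (\sum_(i <- s) F i).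
Proof.
by move=> h; apply: (big_ind (ldeg_le p)) => // x y; exact: ldeg_leD.
Qed.

Lemma ldeg_leM p q a b : ldeg_le p a -> ldeg_le q b -> ldeg_le (p + q) (a * b).
Proof.
move=> ap bq n pqn; rewrite -[LHS]/(conv a b n) (conv_range _ ap bq).
rewrite big1_seq // => i _.
have [pi|ip] := ltP p i; first by rewrite ap // mul0r.
by rewrite bq ?mulr0 //; lia.
Qed.

Lemma deg_leW p q x : p <= q -> deg_le p x -> deg_le q x.
Proof. exact: ldeg_leW. Qed.

Lemma deg_leD p x y : deg_le p x -> deg_le p y -> deg_le p (x + y).
Proof. by rewrite /deg_le rmorphD; exact: ldeg_leD. Qed.

Lemma deg_le0 p : deg_le p 0.
Proof. by rewrite /deg_le rmorph0. Qed.

Lemma deg_le_sum p (I : Type) (s : seq I) (F : I -> R) :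
  (forall i, deg_le p (F i)) -> deg_le p (\sum_(i <- s) F i).
Proof. by move=> h; rewrite /deg_le rmorph_sum; exact: ldeg_le_sum. Qed.

Lemma deg_leM p q x y : deg_le p x -> deg_le q y -> deg_le (p + q) (x * y).
Proof. by rewrite /deg_le rmorphM; exact: ldeg_leM. Qed.

Lemma deg_le_homog k x : x \in G k -> deg_le k x.
Proof.
by move=> xk i ki; rewrite /= (hcomp_homog xk); case: eqP => // ik; lia.
Qed.

Lemma deg_le_ex x : exists p, deg_le p x.
Proof. exact: laurent_ub (laurent_of G x). Qed.

Lemma deg_le_all (I : finType) (F : I -> R) : exists p, forall i, deg_le p (F i).
Proof.
have [p Fp] := choice (fun i => deg_le_ex (F i)).
exists (\sum_i `|p i|) => i; apply: deg_leW (Fp i).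
rewrite (bigD1 i) //=; apply: le_trans (ler_norm _) _.
by rewrite lerDl; apply: sumr_ge0.
Qed.

Lemma tpow_homog k m x : - m <= k -> x \in G k -> x \in tpow_pred G m.
Proof.
move=> mk xk; apply/tpow_predP => i im.
by rewrite (hcomp_homog xk); case: eqP => // ik; lia.
Qed.

Lemma tpowW m n x : m <= n -> x \in tpow_pred G m -> x \in tpow_pred G n.
Proof. by move=> mn /tpow_predP xm; apply/tpow_predP => k kn; apply: xm; lia. Qed.

Lemma tpow0 m : 0 \in tpow_pred G m.
Proof. by have [] := tpow_zmod G m. Qed.

Lemma tpowB m x y :
  x \in tpow_pred G m -> y \in tpow_pred G m -> x - y \in tpow_pred G m.
Proof. by have [_] := tpow_zmod G m; apply. Qed.

Lemma tpowD m x y :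
  x \in tpow_pred G m -> y \in tpow_pred G m -> x + y \in tpow_pred G m.
Proof. by move=> xm ym; rewrite -[y]opprK tpowB // -sub0r tpowB ?tpow0. Qed.

Lemma tpow_sum m (I : Type) (s : seq I) (F : I -> R) :
  (forall i, F i \in tpow_pred G m) -> \sum_(i <- s) F i \in tpow_pred G m.
Proof.
move=> h; apply: (big_ind (fun x => x \in tpow_pred G m)) => // [|x y].
  exact: tpow0.
exact: tpowD.
Qed.

(** A factor of degree 0 leaves a single term in the convolution. This makes truncation and the
    extraction of components right [R_0]-linear. *)
Lemma laurentM0 (a : laurent G) x k : x \in G 0 -> (a * laurent_of G x) k = a k * x.
Proof.
move=> x0; rewrite -[LHS]/(conv _ _ _) (@convE _ _ _ _ k k) => [|i ki].
  rewrite /irange subrr /= big_seq1 addr0 /= subrr.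
  by rewrite (hcomp_homog x0).
rewrite /= (hcomp_homog x0); case: eqP => [|_]; [lia | by rewrite mulr0].
Qed.

Lemma hcompM0 x y k : y \in G 0 -> hcomp G (x * y) k = hcomp G x k * y.
Proof.
by move=> y0; rewrite -[LHS]/(laurent_of G (x * y) k) rmorphM laurentM0.
Qed.

Section Strong.
Hypothesis G_strong : strongly_graded G.

(** Strong grading applied to [1]; it is the form in which strong grading enters all later
    arguments. *)
Lemma unit_decomp (n : int) : exists (l : nat) (a b : 'I_l -> R),
  [/\ forall j, a j \in G n, forall j, b j \in G (- n) &
      \sum_j a j * b j = 1].
Proof.
have [s [sG s1]] := G_strong n (gr_one G).
have sn (j : 'I_(size s)) : nth (0, 0) s j \in s by rewrite mem_nth.
exists (size s), (fun j => (nth (0, 0) s j).1), (fun j => (nth (0, 0) s j).2).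
by split=> [j|j|]; [case: (sG _ (sn j)).. | rewrite s1 (big_nth (0, 0)) big_mkord].
Qed.

(* The direct sum of the [R_k], [lo <= k < lo + len], is a retract of the free
   right [R_0]-module with basis [T]. *)
Lemma window_coord (lo : int) (len : nat) :
  exists (T : finType) (a : T -> R) (c : T -> R -> zero_ring G),
  [/\ forall t, a t \in tpow_pred G (- lo),
      forall t, zmod_morphism (c t),
      forall t x z, c t (x * zero_val z) = c t x * z &
      forall x, \sum_t a t * zero_val (c t x) =
                \sum_(k < len) hcomp G x (lo + k%:Z)].
Proof.
elim: len => [|len [T [a [c [aG cB cM acE]]]]].
  exists void, (of_void R), (of_void _); split=> [[]|[]|[]|x].
  by rewrite big_ord0 big_pred0 // => -[].
(* For the new degree [n = lo + len], write [1] as the sum of the [u_j v_j] with [u_j] in [R_n];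
   then [x_n] has coordinates [v_j x_n] in [R_0] with respect to the [u_j]. *)
have [l [u [v [uG vG uv1]]]] := unit_decomp (lo + len%:Z).
have c0 j x : v j * hcomp G x (lo + len%:Z) \in G 0.
  by have := gr_mul (vG j) (hcomp_gr G x (lo + len%:Z)); rewrite addNr.
exists (T + 'I_l)%type, (fun t => match t with inl t => a t | inr j => u j end),
  (fun t x => match t with inl t => c t x | inr j => ZeroRing (c0 j x) end).
split.
- by case=> [t|j]; [exact: aG | apply: tpow_homog (uG j); lia].
- case=> [t|j]; first exact: cB.
  by move=> x y; apply: val_inj; rewrite /= hcompB mulrBr.
- case=> [t x z|j x z]; first exact: cM.
  by apply: val_inj; rewrite /= hcompM0 ?mulrA //; exact: (valP z).
- move=> x; rewrite big_sumType /= acE big_ord_recr /=; congr (_ + _).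
  under eq_bigr do rewrite mulrA.
  by rewrite -mulr_suml uv1 mul1r.
Qed.

End Strong.

Lemma window_sum (lo : int) (len : nat) x :
  x \in tpow_pred G (- lo) -> deg_le (lo + len%:Z - 1) x ->
  \sum_(k < len) hcomp G x (lo + k%:Z) = x.
Proof.
move=> /tpow_predP xlo xhi; apply: hcomp_inj => i; rewrite hcomp_sum.
under eq_bigr => k _ do rewrite (hcomp_homog (hcomp_gr _ _ _)).
have [ilo|loi] := ltP i lo.
  rewrite xlo ?big1 // => [k _|]; last by lia.
  by case: eqP => // ik; lia.
have [ihi|hii] := ltP i (lo + len%:Z); last first.
  rewrite [RHS]xhi ?big1 // => [k _|]; last by lia.
  by case: eqP => // ik; have := ltn_ord k; lia.
have il : (absz (i - lo) < len)%N by lia.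
rewrite (bigD1 (Ordinal il)) //= big1 ?addr0 => [|k /eqP kN].
  by rewrite (_ : lo + _ = i) ?eqxx //=; lia.
by case: eqP => // ik; case: kN; apply: val_inj => /=; lia.
Qed.

(** A series is bounded above, so only finitely many of its terms have nonnegative degree, and their
    sum lies in [P]. This truncation yields the [R_0]-linear retraction of [mu]. *)
Lemma laurent_trunc a : exists x : pos_ring G,
  forall k, hcomp G (pos_val x) k = if 0 <= k then a k else 0.
Proof.
have [p ap] := laurent_ub a.
pose x := \sum_(k <- irange 0 p) a k.
have xE k : hcomp G x k = if 0 <= k then a k else 0.
  rewrite hcomp_sum; under eq_bigr => i _ do rewrite (hcomp_homog (laurent_gr a i)).
  have [kp|kp] := boolP (k \in irange 0 p).
    rewrite (bigD1_seq k) ?irange_uniq //= eqxx big1 ?addr0 => [|i /negPf ik].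
      by move: kp => /mapP[i _ ->]; rewrite add0r.
    by rewrite eq_sym ik.
  rewrite big1_seq => [|i /andP[_ ip]]; last first.
    by case: eqP => // ki; rewrite ki ip in kp.
  have [k0|pk] := notin_irange kp; last by rewrite ap // if_same.
  by rewrite leNgt k0.
have xpos : x \in pos_pred G by apply/tpow_predP => k k0; rewrite xE; case: leP => //; lia.
by exists (PosRing xpos).
Qed.

End Degrees.

(** * Matrices close to the identity *)

Section NearIdentity.
Variables (R : pzRingType) (G : grading R).

(** The degree filtration is separated, so identities between infinite series can be verified modulo
    arbitrarily low degrees. *)
Lemma ldeg_le_eq0 (a : laurent G) : (forall n : nat, ldeg_le (- n%:Z) a) -> a = 0.
Proof.
by move=> h; apply: laurent_ext => k; apply: (h (absz k).+1); lia.
Qed.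

Definition mxdeg_le (p : int) m n (M : 'M[laurent G]_(m, n)) : Prop :=
  forall i j, ldeg_le p (M i j).

Lemma mxdeg_leD p m n (M N : 'M_(m, n)) :
  mxdeg_le p M -> mxdeg_le p N -> mxdeg_le p (M + N).
Proof. by move=> Mp Np i j; rewrite mxE; exact: ldeg_leD. Qed.

Lemma mxdeg_leN p m n (M : 'M_(m, n)) : mxdeg_le p M -> mxdeg_le p (- M).
Proof. by move=> Mp i j; rewrite mxE; exact: ldeg_leN. Qed.

Lemma mxdeg_leM p q m n r (M : 'M_(m, n)) (N : 'M_(n, r)) :
  mxdeg_le p M -> mxdeg_le q N -> mxdeg_le (p + q) (M *m N).
Proof.
by move=> Mp Nq i j; rewrite mxE; apply: ldeg_le_sum => k; exact: ldeg_leM.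
Qed.

Lemma mxdeg_leW p q m n (M : 'M_(m, n)) : p <= q -> mxdeg_le p M -> mxdeg_le q M.
Proof. by move=> pq Mp i j; exact: ldeg_leW (Mp i j). Qed.

Lemma ldeg_le1 : ldeg_le 0 (1 : laurent G).
Proof. by move=> k k0; rewrite /= hcomp1; case: eqP => // k0'; lia. Qed.

Lemma mxdeg_le1 n : mxdeg_le 0 (1%:M : 'M[laurent G]_n).
Proof.
by move=> i j; rewrite mxE; case: eqP => _; [exact: ldeg_le1 | exact: ldeg_le0].
Qed.

Lemma mxdeg_leX n (M : 'M_n) l : mxdeg_le (-1) M -> mxdeg_le (- l%:Z) (M ^+ l).
Proof.
move=> M1; elim: l => [|l IHl]; first by rewrite oppr0; exact: mxdeg_le1.
by rewrite exprS; apply: mxdeg_leW (mxdeg_leM M1 IHl); lia.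
Qed.

(* The inverse of [1 - E] is the geometric series of [E]. *)
Lemma Omega_plus_near1 k (A : 'M[R]_k) :
  (forall i j, deg_le G (-1) ((1%:M - A) i j)) -> Omega_plus G A.
Proof.
move=> A1; pose E := map_mx (laurent_of G) (1%:M - A).
have E1 : mxdeg_le (-1) E by move=> i j; rewrite mxE; exact: A1.
have AE : map_mx (laurent_of G) A = 1 - E.
  by rewrite /E map_mxB map_mx1 subKr.
pose S n := \sum_(l < n) E ^+ l.
(* The tail consists of powers [E ^+ l] with [l >= m], and [E] has degree at most [-1]. *)
have SD m n i j : ldeg_le (- m%:Z) (S (m + n)%N i j - S m i j).
  rewrite /S big_split_ord /= !mxE addrAC subrr add0r summxE; apply: ldeg_le_sum => l.
  have h := @mxdeg_leX _ E (m + l) E1 i j. apply: ldeg_leW h; lia.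
have S0 n i j : ldeg_le 0 (S n i j).
  by have := SD 0 n i j; rewrite /S big_ord0 mxE subr0 oppr0.
(* The coefficient at degree [k] is read off the partial sum with [|k| + 1] terms: all later terms
   have degree at most [-|k| - 1], hence below [k]. *)
have BP i j : (fun k : int => S (absz k).+1 i j k) \in laurent_pred G.
  apply/laurent_predP; split=> [l|]; first exact: laurent_gr.
  by exists 0 => l l0; exact: S0.
pose B : 'M[laurent G]_k := \matrix_(i, j) Laurent (BP i j).
have BS n : mxdeg_le (- n%:Z) (B - S n).
  move=> i j l nl; rewrite !mxE -[LHS]/(S (absz l).+1 i j l - S n i j l).
  have [l0|l0] := ltP 0 l; first by rewrite !S0 ?subrr.
  have nE : n = ((absz l).+1 + (n - (absz l).+1))%N by lia.
  have := SD (absz l).+1 (n - (absz l).+1)%N i j l; rewrite -nE => h.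
  apply/eqP; rewrite -oppr_eq0 opprB; apply/eqP.
  by rewrite -[LHS]/((S n i j - S (absz l).+1 i j) l) h //; lia.
have A0 : mxdeg_le 0 (1 - E).
  apply: mxdeg_leD; first exact: mxdeg_le1.
  by apply: mxdeg_leN; apply: mxdeg_leW E1.
have telL n : (1 - E) * S n = 1 - E ^+ n.
  by rewrite -opprB mulNr /S -subrX1 opprB.
have telR n : S n * (1 - E) = 1 - E ^+ n.
  rewrite -telL mulrBl mulrBr mul1r mulr1 /S mulr_suml mulr_sumr.
  by congr (_ - _); apply: eq_bigr => i _; rewrite -exprSr -exprS.
(* Both identities are compared down to degree [-n] for every [n]. There [B] may be replaced by
   [S n], whose product with [1 - E] telescopes to [1 - E ^+ n]. *)
exists B; rewrite AE; split; apply/matrixP => i j; apply/eqP; rewrite -subr_eq0;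
  apply/eqP/ldeg_le_eq0 => n.
- have -> : ((1 - E) *m B) i j - 1%:M i j =
      ((1 - E) *m (B - S n) - E ^+ n) i j.
    rewrite mulmxBr -[X in _ - X - _]/((1 - E) * S n) telL.
    by rewrite opprB addrA [X in _ = fun_of_matrix X _ _]addrAC addrK !mxE.
  apply: mxdeg_leD; last by apply/mxdeg_leN/mxdeg_leX.
  by have := mxdeg_leM A0 (BS n); rewrite add0r.
- have -> : (B *m (1 - E)) i j - 1%:M i j =
      ((B - S n) *m (1 - E) - E ^+ n) i j.
    rewrite mulmxBl -[X in _ - X - _]/(S n * (1 - E)) telR.
    by rewrite opprB addrA [X in _ = fun_of_matrix X _ _]addrAC addrK !mxE.
  apply: mxdeg_leD; last by apply/mxdeg_leN/mxdeg_leX.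
  by have := mxdeg_leM (BS n) A0; rewrite addr0.
Qed.

End NearIdentity.

(** * Coordinates in free modules *)

Section Linear.
Variable K : pzRingType.
Implicit Types M N : lmodType K^c.

Lemma linear_of M N (g : M -> N) :
  linear g -> exists g' : {linear M -> N}, g' =1 g.
Proof.
move=> glin; pose gL := GRing.isLinear.Build _ _ _ _ g glin.
pose g' : {linear M -> N} := HB.pack g gL.
by exists g'.
Qed.

Lemma linear_inverse M N (g : {linear M -> N}) : bijective g ->
  exists g' : {linear N -> M}, cancel g g' /\ cancel g' g.
Proof.
case=> g' gK g'K; have [u uE] := linear_of (can2_linear gK g'K).
by exists u; split=> x; rewrite uE.
Qed.

Definition ffun_delta (I : finType) (i : I) : {ffun I -> (K^c)^o} :=
  [ffun j => (j == i)%:R].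

Lemma ffun_basis (I : finType) (x : {ffun I -> (K^c)^o}) :
  x = \sum_i (x i : K^c) *: ffun_delta i.
Proof.
apply/ffunP => i; rewrite sum_ffunE (bigD1 i) //= !ffunE eqxx.
rewrite -[_ *: _]/((x i : K^c) * 1) mulr1 big1 ?addr0 // => j ji.
by rewrite !ffunE eq_sym (negPf ji) scaler0.
Qed.

End Linear.

Lemma mulmx_scalar1 (S : pzRingType) k (v : 'cV[S]_k) (x : S) i :
  (v *m x%:M) i 0 = v i 0 * x.
Proof. by rewrite mxE big_ord1 mxE eqxx mulr1n. Qed.

Section Coordinates.
Variables (R : pzRingType) (G : grading R).
Local Notation P := (pos_ring G).

Definition mtpow (m : int) p q (A : 'M[R]_(p, q)) : Prop :=
  forall i j, A i j \in tpow_pred G m.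

Definition mdeg_le (d : int) p q (A : 'M[R]_(p, q)) : Prop :=
  forall i j, deg_le G d (A i j).

Lemma mtpowB m p q (A B : 'M_(p, q)) : mtpow m A -> mtpow m B -> mtpow m (A - B).
Proof. by move=> Am Bm i j; rewrite !mxE tpowB. Qed.

Lemma mtpowD m p q (A B : 'M_(p, q)) : mtpow m A -> mtpow m B -> mtpow m (A + B).
Proof. by move=> Am Bm i j; rewrite !mxE tpowD. Qed.

Lemma mtpow_sum m p q (I : Type) (s : seq I) (F : I -> 'M_(p, q)) :
  (forall i, mtpow m (F i)) -> mtpow m (\sum_(i <- s) F i).
Proof. by move=> Fm i j; rewrite summxE; apply: tpow_sum => k; exact: Fm. Qed.

Lemma mtpowW m n p q (A : 'M_(p, q)) : m <= n -> mtpow m A -> mtpow n A.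
Proof. by move=> mn Am i j; exact: tpowW (Am i j). Qed.

Lemma mtpowM m n p q r (A : 'M_(p, q)) (B : 'M_(q, r)) :
  mtpow m A -> mtpow n B -> mtpow (m + n) (A *m B).
Proof.
by move=> Am Bn i j; rewrite mxE; apply: tpow_sum => k; exact: tpow_mul.
Qed.

Lemma mtpow_scalar m p (x : R) : x \in tpow_pred G m -> mtpow m (x%:M : 'M_p).
Proof. by move=> xm i j; rewrite mxE; case: eqP => // _; exact: tpow0. Qed.

Lemma mdeg_leD d p q (A B : 'M_(p, q)) :
  mdeg_le d A -> mdeg_le d B -> mdeg_le d (A + B).
Proof. by move=> Ad Bd i j; rewrite mxE; exact: deg_leD. Qed.

Lemma mdeg_le_sum d p q (I : Type) (s : seq I) (F : I -> 'M_(p, q)) :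
  (forall i, mdeg_le d (F i)) -> mdeg_le d (\sum_(i <- s) F i).
Proof. by move=> Fd i j; rewrite summxE; apply: deg_le_sum => k; exact: Fd. Qed.

Lemma mdeg_leW d e p q (A : 'M_(p, q)) : d <= e -> mdeg_le d A -> mdeg_le e A.
Proof. by move=> de Ad i j; exact: deg_leW (Ad i j). Qed.

Lemma mdeg_leM d e p q r (A : 'M_(p, q)) (B : 'M_(q, r)) :
  mdeg_le d A -> mdeg_le e B -> mdeg_le (d + e) (A *m B).
Proof.
by move=> Ad Be i j; rewrite mxE; apply: deg_le_sum => k; exact: deg_leM.
Qed.

Lemma mdeg_le_scalar d p (x : R) : deg_le G d x -> mdeg_le d (x%:M : 'M_p).
Proof. by move=> xd i j; rewrite mxE; case: eqP => // _; exact: deg_le0. Qed.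

Lemma mdeg_le_ex p q (A : 'M[R]_(p, q)) : exists d, mdeg_le d A.
Proof.
have [d Ad] := deg_le_all G (fun ij : 'I_p * 'I_q => A ij.1 ij.2).
by exists d => i j; exact: (Ad (i, j)).
Qed.

(* Column vectors over [R] form a right [P]-module, on which the matrix algebra
   acts from the left; [a in P] acts as the scalar 1 x 1 matrix [a]. *)
Definition colinear (M : lmodType P^c) k (X : M -> 'cV[R]_k) : Prop :=
  (forall x y, X (x + y) = X x + X y) /\
  forall (a : P^c) x, X (a *: x) = X x *m (pos_val a)%:M.

Section Colinear.
Variables (M : lmodType P^c) (k : nat) (X : M -> 'cV[R]_k).
Hypothesis Xlin : colinear X.

Lemma colinear0 : X 0 = 0.
Proof. by apply: (@addIr _ (X 0)); rewrite -Xlin.1 addr0 add0r. Qed.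

Lemma colinearB x y : X (x - y) = X x - X y.
Proof.
by apply: (@addIr _ (X y)); rewrite -Xlin.1 !subrK.
Qed.

Lemma colinear_sum (I : Type) (s : seq I) (F : I -> M) :
  X (\sum_(i <- s) F i) = \sum_(i <- s) X (F i).
Proof. by apply: (big_morph X) => //; [exact: Xlin.1 | exact: colinear0]. Qed.

Lemma colinear_mul l (A : 'M_(l, k)) : colinear (fun x => A *m X x).
Proof.
by split=> [x y|a x]; [rewrite Xlin.1 mulmxDr | rewrite Xlin.2 mulmxA].
Qed.

Lemma colinear_comp (N : lmodType P^c) (u : {linear N -> M}) :
  colinear (fun x => X (u x)).
Proof.
by split=> [x y|a x]; [rewrite linearD Xlin.1 | rewrite linearZ Xlin.2].
Qed.

(** Lets linear maps be prescribed by their effect on coordinates: since [X] is injective, linearity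
    of the lift is inherited from [Y]. *)
Lemma linear_lift (N : lmodType P^c) (Y : N -> 'cV[R]_k) :
  colinear Y -> injective X -> (forall y, exists x, X x = Y y) ->
  exists g : {linear N -> M}, forall y, X (g y) = Y y.
Proof.
move=> Ylin Xinj XY; have [g gE] := choice XY.
have glin : linear g.
  by move=> a x y; apply: Xinj; rewrite Xlin.1 Xlin.2 !gE Ylin.1 Ylin.2.
by have [g' g'E] := linear_of glin; exists g' => y; rewrite g'E gE.
Qed.
End Colinear.

Definition pos_col k (x : {ffun 'I_k -> (P^c)^o}) : 'cV[R]_k :=
  \col_i pos_val (x i).
Definition tpow_col m k (x : {ffun 'I_k -> tpow G m}) : 'cV[R]_k :=
  \col_i tpow_val (x i).

Lemma pos_col_lin k : colinear (@pos_col k).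
Proof.
split=> [x y|a x]; apply/colP => i; last by rewrite mulmx_scalar1 !mxE ffunE.
by rewrite !mxE ffunE.
Qed.

Lemma tpow_col_lin m k : colinear (@tpow_col m k).
Proof.
split=> [x y|a x]; apply/colP => i; last by rewrite mulmx_scalar1 !mxE ffunE.
by rewrite !mxE ffunE.
Qed.

Lemma pos_col_inj k : injective (@pos_col k).
Proof.
by move=> x y /colP xy; apply/ffunP => i; apply: val_inj; have := xy i; rewrite !mxE.
Qed.

Lemma tpow_col_inj m k : injective (@tpow_col m k).
Proof.
by move=> x y /colP xy; apply/ffunP => i; apply: val_inj; have := xy i; rewrite !mxE.
Qed.

Lemma pos_colP k (x : {ffun 'I_k -> (P^c)^o}) : mtpow 0 (pos_col x).
Proof. by move=> i j; rewrite mxE; exact: valP. Qed.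

Lemma tpow_colP m k (x : {ffun 'I_k -> tpow G m}) : mtpow m (tpow_col x).
Proof. by move=> i j; rewrite mxE; exact: valP. Qed.

Lemma pos_col_surj k (v : 'cV[R]_k) : mtpow 0 v -> exists x, pos_col x = v.
Proof.
move=> v0; exists [ffun i => PosRing (v0 i 0) : (P^c)^o].
by apply/colP => i; rewrite mxE ffunE.
Qed.

Lemma tpow_col_surj m k (v : 'cV[R]_k) : mtpow m v -> exists x, @tpow_col m k x = v.
Proof.
move=> vm; exists [ffun i => TPow (vm i 0)].
by apply/colP => i; rewrite mxE ffunE.
Qed.

Lemma mu_col m k (A : 'M[R]_k) (Am : suitable G A m) x :
  tpow_col (mu Am x) = A *m pos_col x.
Proof.
apply/colP => i; rewrite !mxE mu_funE; apply: eq_bigr => j _.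
by rewrite mxE.
Qed.

End Coordinates.

(** * Free modules in coordinates over [R], and degree bounds for [R_0]-linear maps *)

Section Frames.
Variables (R : pzRingType) (G : grading R).
Hypothesis G_strong : strongly_graded G.
Local Notation P := (pos_ring G).
Local Notation z2p := (@zero_to_pos R G).

(** A basis of [M], recorded as an isomorphism with the columns over [P] inside the columns over
    [R]. Matrices with entries of negative degree can then act on coordinates. *)
Definition frame (M : lmodType P^c) k (X : M -> 'cV[R]_k) : Prop :=
  [/\ colinear X, injective X, forall x, mtpow G 0 (X x) &
      forall v, mtpow G 0 v -> exists x, X x = v].

Lemma frame_matrix (M N : lmodType P^c) k l (X : M -> 'cV[R]_k) (Y : N -> 'cV[R]_l)
    (u : {linear M -> N}) : frame X -> frame Y ->
  exists2 D : 'M[R]_(l, k), mtpow G 0 D & forall x, Y (u x) = D *m X x.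
Proof.
move=> [Xlin Xinj Xpos Xsurj] [Ylin Yinj Ypos Ysurj].
have dpos (j : 'I_k) : mtpow G 0 (delta_mx j 0 : 'cV[R]_k).
  by move=> i i'; rewrite mxE; case: (_ && _); [exact: tpow_one | exact: tpow0].
have [e eE] := choice (fun j => Xsurj _ (dpos j)).
exists (\matrix_(i, j) Y (u (e j)) i 0) => [i j|x]; first by rewrite mxE; exact: Ypos.
have -> : x = \sum_j (PosRing (Xpos x j 0) : P^c) *: e j.
  apply: Xinj; rewrite (colinear_sum Xlin); apply/colP => i.
  rewrite summxE (bigD1 i) //= Xlin.2 mulmx_scalar1 eE mxE !eqxx mul1r.
  rewrite big1 ?addr0 // => j ji.
  by rewrite Xlin.2 mulmx_scalar1 eE mxE eq_sym (negPf ji) mul0r.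
rewrite linear_sum (colinear_sum Ylin) (colinear_sum Xlin) mulmx_sumr.
apply: eq_bigr => j _; rewrite linearZ Ylin.2 Xlin.2 mulmxA; congr (_ *m _).
apply/colP => i; rewrite eE mxE (bigD1 j) //= !mxE !eqxx mulr1.
by rewrite big1 ?addr0 // => j' /negPf jj'; rewrite !mxE jj' mulr0.
Qed.

(* The vectors of degree at most [p] form a finitely generated [R_0]-module. *)
Lemma frame_bound (M N : lmodType P^c) k l (X : M -> 'cV[R]_k) (Y : N -> 'cV[R]_l)
    (u : {linear restr z2p M -> restr z2p N}) (p : int) : frame X -> frame Y ->
  exists e, forall x : M, mdeg_le G p (X x) -> mdeg_le G e (Y (u x)).
Proof.
move=> [Xlin Xinj Xpos Xsurj] [Ylin Yinj Ypos Ysurj].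
(* The window of degrees [0] to [|p|] contains every degree that a vector over [P] of degree at most
   [p] can have. *)
have [T [a [c [aG cB cM acE]]]] := window_coord G_strong 0 (absz p).+1.
have apos (ti : T * 'I_k) : mtpow G 0 (a ti.1 *: delta_mx ti.2 0 : 'cV[R]_k).
  move=> i j; rewrite !mxE; case: (_ && _); last by rewrite mulr0 tpow0.
  by rewrite mulr1 -oppr0.
have [w wE] := choice (fun ti => Xsurj _ (apos ti)).
have [e eP] := deg_le_all G (fun tij : T * 'I_k * 'I_l => Y (u (w tij.1)) tij.2 0).
exists e => x xp.
(* Only [R_0]-linearity of [u] is available, so [x] is expanded over [R_0] in the finitely many
   [w (t, i)]. Scalars of degree 0 do not raise the bound on their images. *)
have xE : x = \sum_i \sum_t (z2p (c t (X x i 0)) : P^c) *: w (t, i).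
  apply: Xinj; rewrite (colinear_sum Xlin); apply/colP => i; rewrite summxE.
  rewrite (bigD1 i) //= [X in _ + X]big1 => [|i' /negPf ii']; last first.
    rewrite (colinear_sum Xlin) summxE; apply: big1 => t _.
    by rewrite Xlin.2 mulmx_scalar1 wE !mxE eq_sym ii' mulr0 mul0r.
  rewrite addr0 (colinear_sum Xlin) summxE.
  under eq_bigr do rewrite Xlin.2 mulmx_scalar1 wE !mxE !eqxx mulr1.
  rewrite acE window_sum //; first by rewrite oppr0; exact: Xpos.
  by apply: deg_leW (xp i 0); lia.
have -> : u x = \sum_i \sum_t (c t (X x i 0) : (zero_ring G)^c) *: u (w (t, i)).
  rewrite {1}xE linear_sum; apply: eq_bigr => i _.
  by rewrite linear_sum; apply: eq_bigr => t _; rewrite -linearZ.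
rewrite (colinear_sum Ylin); apply: mdeg_le_sum => i.
rewrite (colinear_sum Ylin); apply: mdeg_le_sum => t j j'; rewrite (ord1 j').
rewrite -[X in Y X]/((z2p (c t (X x i 0)) : P^c) *: (u (w (t, i)) : N)).
rewrite Ylin.2 mulmx_scalar1 -[e]addr0; apply: deg_leM; first exact: (eP (t, i, j)).
by apply: deg_le_homog; exact: (valP (c t (X x i 0))).
Qed.

(** The map factors through a finitely generated [R_0]-module, so its values are [R_0]-combinations
    of finitely many vectors, and [R_0] preserves degrees. *)
Lemma finite_bound (M : lmodType P^c) k (X : M -> 'cV[R]_k)
    (N : lmodType (zero_ring G)^c)
    (i : {linear restr z2p M -> N}) (r : {linear N -> restr z2p M}) :
  frame X -> fg_free_mod N -> exists q, forall x : M, mdeg_le G q (X (r (i x))).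
Proof.
move=> [Xlin _ _ _] [l [phi phi_bij]].
have [psi [_ psiK]] := linear_inverse phi_bij.
pose e j := r (phi (ffun_delta _ j)).
have [q qP] := deg_le_all G (fun ij : 'I_k * 'I_l => X (e ij.2) ij.1 0).
exists q => x; rewrite -[i x]psiK [psi _]ffun_basis !linear_sum (colinear_sum Xlin).
apply: mdeg_le_sum => j i1 j1; rewrite (ord1 j1) !linearZ.
rewrite -[y in X y]/((z2p (psi (i x) j) : P^c) *: (e j : M)).
rewrite Xlin.2 mulmx_scalar1 -[q]addr0; apply: deg_leM.
  exact: (qP (i1, j)).
by apply: deg_le_homog; exact: (valP (psi (i x) j : zero_ring G)).
Qed.

End Frames.

(** * Approximate contractions over [R] *)

Section ApproximateContraction.
Variables (R : pzRingType) (G : grading R).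
Hypothesis G_strong : strongly_graded G.
Local Notation P := (pos_ring G).
Local Notation z2p := (@zero_to_pos R G).
Variables (C : complex P) (r : int -> nat) (X : forall n, C n -> 'cV[R]_(r n)).
Hypothesis X_frame : forall n, frame (@X n).
Variable D : forall n : int, 'M[R]_(r n, r (n + 1)).
Hypothesis D_pos : forall n, mtpow G 0 (D n).
Hypothesis D_diff : forall n x, X (cdiff C n x) = D n *m X x.

Lemma col_inj p q (A A' : 'M[R]_(p, q)) : (forall j, col j A = col j A') -> A = A'.
Proof.
by move=> AA'; apply/matrixP => i j; have /colP/(_ i) := AA' j; rewrite !mxE.
Qed.

Lemma mtpow_col m p q (A : 'M[R]_(p, q)) j : mtpow G m A -> mtpow G m (col j A).
Proof. by move=> Am i j'; rewrite mxE; exact: Am. Qed.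

Lemma mtpow1 p : mtpow G 0 (1%:M : 'M[R]_p).
Proof. exact/mtpow_scalar/tpow_one. Qed.

Lemma frame_diffK n : D n *m D (n + 1) = 0.
Proof.
apply: col_inj => j; rewrite colE -mulmxA.
have [Xlin _ _ Xsurj] := X_frame (n + 1 + 1).
have [|x xE] := Xsurj (col j 1%:M); first exact/mtpow_col/mtpow1.
rewrite colE mul1mx in xE; rewrite -xE -D_diff -D_diff cdiffK.
by have [Xlin' _ _ _] := X_frame n; rewrite (colinear0 Xlin') colE mul0mx.
Qed.

Variable h : forall n : int, {linear restr z2p (C n) -> restr z2p (C (n + 1))}.
Variable g : forall n : int, C n -> C n.
Hypothesis hg : forall n (x : C (n + 1)),
  x = cdiff C (n + 1) (h (n + 1) x) + h n (cdiff C n x) + g x.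
Hypothesis g_bound : forall n, exists q, forall x, mdeg_le G q (X (@g n x)).

Lemma coord_inv : exists Y : forall n, 'cV[R]_(r n) -> C n,
  forall n v, mtpow G 0 v -> X (Y n v) = v.
Proof.
have Xinv n : exists Y : 'cV[R]_(r n) -> C n, forall v, mtpow G 0 v -> X (Y v) = v.
  have [_ _ _ Xsurj] := X_frame n.
  have Xv (v : 'cV[R]_(r n)) : exists x : C n, mtpow G 0 v -> X x = v.
    (* Vectors with entries outside [P] receive the default lift [0]. *)
    have [v0|nv0] := pselect (mtpow G 0 v); last by exists 0.
    by have [x xE] := Xsurj v v0; exists x.
  by have [Y YE] := choice Xv; exists Y.
by exists (fun n => projT1 (cid (Xinv n))) => n; exact: projT2 (cid (Xinv n)).
Qed.

Section Shifted.
Variable Y : forall n, 'cV[R]_(r n) -> C n.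
Hypothesis YE : forall n (v : 'cV[R]_(r n)), mtpow G 0 v -> X (Y v) = v.
Variables (N : nat) (l : nat) (a b : 'I_l -> R).
Hypothesis aG : forall j, a j \in G N%:Z.
Hypothesis bG : forall j, b j \in G (- N%:Z).
Hypothesis ab1 : \sum_j a j * b j = 1.

(* [h] conjugated by the shift [t^N]; it is defined on vectors over [t^-N P]. *)
Definition shifted_htpy n (v : 'cV[R]_(r n)) : 'cV[R]_(r (n + 1)) :=
  \sum_j X (h n (Y (v *m (a j)%:M))) *m (b j)%:M.

Lemma a_tpow j : a j \in tpow_pred G (- N%:Z).
Proof. by apply: tpow_homog (aG j); lia. Qed.

Lemma b_tpow j : b j \in tpow_pred G N%:Z.
Proof. by apply: tpow_homog (bG j); lia. Qed.

Lemma mtpow_a p (v : 'cV[R]_p) j : mtpow G N%:Z v -> mtpow G 0 (v *m (a j)%:M).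
Proof.
move=> vN; rewrite -(subrr N%:Z).
by apply: mtpowM => //; apply: mtpow_scalar; exact: a_tpow.
Qed.

Lemma shifted_htpy_tpow n v : mtpow G N%:Z (@shifted_htpy n v).
Proof.
apply: mtpow_sum => j; rewrite -[N%:Z]add0r; apply: mtpowM.
  by have [_ _ Xpos _] := X_frame (n + 1); exact: Xpos.
by apply: mtpow_scalar; exact: b_tpow.
Qed.

(** Each [v a_j] is a vector over [P], so [hg] applies to its lift; multiplying by [b_j] and summing
    recovers [v]. The matrices [D] act from the left and commute with these right
    multiplications. *)
Lemma shifted_htpyE n (v : 'cV[R]_(r (n + 1))) : mtpow G N%:Z v ->
  v - D (n + 1) *m shifted_htpy v =
  shifted_htpy (D n *m v) + \sum_j X (g (Y (v *m (a j)%:M))) *m (b j)%:M.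
Proof.
move=> vN; apply/eqP; rewrite subr_eq; apply/eqP; rewrite [RHS]addrC [RHS]addrA.
rewrite {1}(_ : v = \sum_j v *m (a j)%:M *m (b j)%:M); last first.
  under eq_bigr do rewrite -mulmxA -scalar_mxM.
  by rewrite -mulmx_sumr -raddf_sum ab1 mulmx1.
rewrite /shifted_htpy mulmx_sumr -!big_split; apply: eq_bigr => j _ /=.
rewrite mulmxA -!mulmxDl; congr (_ *m _).
have va := mtpow_a j vN.
have [Xlin Xinj _ _] := X_frame (n + 1); have [_ Xinj' _ _] := X_frame n.
rewrite -{1}(YE va) {1}[Y _]hg !Xlin.1 D_diff; congr (_ + X (h n _) + _).
(* The differential of the lift of [v a_j] is the lift of [D v a_j], as both have the same
   coordinates. *)
have dva : mtpow G 0 (D n *m v *m (a j)%:M).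
  by apply: mtpow_a; rewrite -[N%:Z]add0r; exact: mtpowM.
by apply: Xinj'; rewrite D_diff (YE va) (YE dva) mulmxA.
Qed.

(** Multiplication by [a_j] raises degrees by [N] before [h] is applied, and [b_j] lowers them again
    afterwards. Hence one bound for [h] serves all [N]. *)
Lemma shifted_htpy_deg n p e (v : 'cV[R]_(r n)) : mtpow G N%:Z v ->
  (forall x, mdeg_le G p (X x) -> mdeg_le G e (X (h n x))) ->
  mdeg_le G (p - N%:Z) v -> mdeg_le G (e - N%:Z) (shifted_htpy v).
Proof.
move=> vN he vp; apply: mdeg_le_sum => j; apply: mdeg_leM.
  apply: he; rewrite YE; last exact: mtpow_a.
  rewrite -[p](subrK N%:Z); apply: mdeg_leM => //.
  by apply: mdeg_le_scalar; exact: deg_le_homog.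
by apply: mdeg_le_scalar; exact: deg_le_homog.
Qed.

End Shifted.

Variable B : nat.
Hypothesis rB : forall n : int, (B < `|n|)%N -> r n = 0%N.

(** Induction upwards from the lowest degree. The constant [e] is quantified before [N], so that a
    large [N] makes the error negative. *)
Lemma approximate_contraction (k : nat) : exists e : int, forall N : nat,
  exists S : forall n : int, 'M[R]_(r (n + 1), r n),
  (forall n, mtpow G N%:Z (S n)) /\
  forall n : int, n <= k%:Z - B%:Z - 2 ->
    mdeg_le G (e - N%:Z) (1%:M - D (n + 1) *m S (n + 1) - S n *m D n).
Proof.
have [Y YE] := coord_inv.
elim: k => [|k [e IHk]].
  (* For [n <= -B - 2] the matrix to be bounded has size [r (n + 1) = 0]. *)
  exists 0 => N; exists (fun n => 0); split=> [n i j|n nB i].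
    by rewrite mxE tpow0.
  by have := ltn_ord i; rewrite [X in (_ < X)%N]rB //; lia.
pose n := k%:Z - B%:Z - 2.
(* The bounds [q], [q'] and [e'] for [D], [g] and [h] are fixed before [N]; [e + q] will bound the
   unshifted arguments of [h]. *)
have [q Dq] := mdeg_le_ex G (D (n + 1)).
have [q' gq'] := g_bound (n + 1 + 1).
have [e' he'] := frame_bound G_strong (h (n + 1)) (e + q)
  (X_frame (n + 1)) (X_frame (n + 1 + 1)).
exists (Num.max e (Num.max e' q')) => N.
have [S [SN SE]] := IHk N.
have [l [a [b [aG bG ab1]]]] := unit_decomp G_strong N%:Z.
pose Z : 'M[R]_(r (n + 1 + 1)) := 1%:M - S (n + 1) *m D (n + 1).
have ZN : mtpow G N%:Z Z.
  apply: mtpowB; first by have h1 := @mtpow1 (r (n + 1 + 1)); apply: mtpowW h1; lia.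
  by rewrite -[N%:Z]addr0; exact: mtpowM.
(* The shifted homotopy is not [P]-linear. Its values on the columns of [Z] are taken as the columns
   of a matrix, which is the [P]-linear extension. *)
pose T : 'M[R]_(r (n + 1 + 1 + 1), r (n + 1 + 1)) :=
  \matrix_(i, j) shifted_htpy Y a b (col j Z) i 0.
(* Only index [n + 2] is changed; the relations at indices up to [n] involve [S] at indices up to
   [n + 1] and survive. *)
pose S' : forall n : int, 'M[R]_(r (n + 1), r n) := @dfwith _ _ S (n + 1 + 1) T.
exists S'; split=> [m|m].
  have [->|mn] := eqVneq m (n + 1 + 1).
    rewrite /S' dfwith_in => i j; rewrite mxE.
    apply: (shifted_htpy_tpow Y a bG (col j Z)).
  by rewrite /S' dfwith_out // eq_sym.
rewrite -addn1 PoszD => mk.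
have [mn|mn] : m <= n \/ m = n + 1 by rewrite /n; lia.
  have mE := SE m mn; rewrite /S' !dfwith_out; try by apply/eqP; lia.
  by apply: mdeg_leW mE; rewrite lerD2r le_max lexx.
rewrite {}mn {m mk}.
have -> : S' (n + 1 + 1) = T by rewrite /S' dfwith_in.
have -> : S' (n + 1) = S (n + 1) by rewrite /S' dfwith_out //; apply/eqP; lia.
rewrite [X in mdeg_le _ _ X]addrAC -/Z => i j.
have -> : (Z - D (n + 1 + 1) *m T) i j =
    (col j Z - D (n + 1 + 1) *m shifted_htpy Y a b (col j Z)) i 0.
  by rewrite !mxE; congr (_ - _); apply: eq_bigr => i' _; rewrite mxE.
rewrite (shifted_htpyE YE aG ab1); last exact: mtpow_col.
set W := (X in fun_of_matrix X i 0).
suff : mdeg_le G (Num.max e (Num.max e' q') - N%:Z) W by apply.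
apply: mdeg_leD.
  apply: (@mdeg_leW _ _ (e' - N%:Z)); first by rewrite lerD2r !le_max lexx orbT.
  apply: (shifted_htpy_deg YE aG bG _ he').
    by rewrite -[N%:Z]add0r; apply: mtpowM => //; exact: mtpow_col.
  (* Since [D n *m D (n + 1) = 0], the term [S n *m D n] may be inserted, which exposes the previous
     error matrix, of degree at most [e - N]. *)
  have -> : D (n + 1) *m col j Z =
      (1%:M - D (n + 1) *m S (n + 1) - S n *m D n) *m col j (D (n + 1)).
    rewrite !colE !mulmxA; congr (_ *m _).
    rewrite mulmxBr mulmxBl -[S n *m D n *m _]mulmxA frame_diffK mulmx0 subr0.
    by rewrite mulmxBl mulmx1 mul1mx mulmxA.
  rewrite (_ : e + q - N%:Z = e - N%:Z + q); last by lia.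
  apply: mdeg_leM (SE n (lexx _)) _ => i1 j1.
  by rewrite mxE; exact: Dq.
apply: (@mdeg_leW _ _ (q' - N%:Z)); first by rewrite lerD2r !le_max lexx !orbT.
apply: mdeg_le_sum => j'; apply: mdeg_leM; first exact: gq'.
by apply: mdeg_le_scalar; exact: deg_le_homog.
Qed.
End ApproximateContraction.

Lemma dep_choice (I : Type) (T : I -> Type) (Q : forall i, T i -> Prop) :
  (forall i, exists x, Q i x) -> exists f : forall i, T i, forall i, Q i (f i).
Proof.
by move=> h; exists (fun i => projT1 (cid (h i))) => i; exact: projT2 (cid (h i)).
Qed.

(** * Contractibility over the localisation *)

Section Tensor.
Variables (K S : pzRingType) (f : {rmorphism K -> S}).
Implicit Types M N : lmodType K^c.

Definition pure_tensor M (x : M) (s : S) : tensor f M := tens_sum f [:: (x, s)].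

Lemma tensor_ind M (Q : tensor f M -> Prop) :
  Q 0 -> (forall x y, Q x -> Q y -> Q (x + y)) -> (forall x s, Q (pure_tensor x s)) ->
  forall x, Q x.
Proof.
move=> Q0 QD Qp x; rewrite -[x]tens_reprK; elim: (tens_repr x) => [|[m s] u IHu].
  exact: Q0.
by rewrite -[_ :: u]cat1s -tens_add_sum; exact: QD (Qp m s) IHu.
Qed.

Lemma tens_map_pure M N (g : {linear M -> N}) x s :
  tens_map f g (pure_tensor x s) = pure_tensor (g x) s.
Proof. exact: tens_map_sum. Qed.

Lemma pure_tensorD M (x y : M) s :
  pure_tensor (x + y) s = pure_tensor x s + pure_tensor y s.
Proof.
rewrite [RHS]tens_add_sum; apply/tens_sumP; exact: TensAddl.
Qed.

Lemma tens_map_comp M N N' (g : {linear N -> N'}) (h : {linear M -> N})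
    (k : {linear M -> N'}) :
  (forall x, k x = g (h x)) ->
  forall x, tens_map f k x = tens_map f g (tens_map f h x).
Proof.
move=> kE; elim/tensor_ind => [|x y IHx IHy|x s]; first by rewrite !linear0.
  by rewrite !linearD IHx IHy.
by rewrite !tens_map_pure kE.
Qed.

Lemma tens_map_square M N N' N'' (g : {linear N -> N'}) (h : {linear M -> N})
    (g' : {linear N'' -> N'}) (h' : {linear M -> N''}) :
  (forall x, g (h x) = g' (h' x)) ->
  forall x, tens_map f g (tens_map f h x) = tens_map f g' (tens_map f h' x).
Proof.
move=> gh x; rewrite -(@tens_map_comp _ _ _ g h (g \o h)) //.
by rewrite -(@tens_map_comp _ _ _ g' h' (g \o h)).
Qed.

Lemma tens_mapD M N (g h k : {linear M -> N}) : (forall x, k x = g x + h x) ->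
  forall x, tens_map f k x = tens_map f g x + tens_map f h x.
Proof.
move=> kE; elim/tensor_ind => [|x y IHx IHy|x s]; first by rewrite !linear0 addr0.
  by rewrite !linearD IHx IHy addrACA.
by rewrite !tens_map_pure kE pure_tensorD.
Qed.

Lemma tens_map_id M (k : {linear M -> M}) : (forall x, k x = x) ->
  forall x, tens_map f k x = x.
Proof.
move=> kE; elim/tensor_ind => [|x y IHx IHy|x s]; first by rewrite linear0.
  by rewrite linearD IHx IHy.
by rewrite tens_map_pure kE.
Qed.

Lemma tens_map0 M N (k : {linear M -> N}) : (forall x, k x = 0) ->
  forall x, tens_map f k x = 0.
Proof.
move=> kE; elim/tensor_ind => [|x y IHx IHy|x s]; first by rewrite linear0.
  by rewrite linearD IHx IHy addr0.
rewrite tens_map_pure kE; apply/tens_sumP; exact: TensZero.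
Qed.

Lemma tens_map_bij M N (g : {linear M -> N}) : bijective g -> bijective (tens_map f g).
Proof.
move=> /linear_inverse[g' [gK g'K]]; exists (tens_map f g') => x.
  rewrite -(@tens_map_comp _ _ _ g' g idfun) ?tens_map_id // => y.
  by rewrite /= gK.
rewrite -(@tens_map_comp _ _ _ g g' idfun) ?tens_map_id // => y.
by rewrite /= g'K.
Qed.

End Tensor.

(** * From inverted matrices to contractions *)

Section InvertingMakesContractible.
Variables (R : pzRingType) (G : grading R).
Hypothesis G_strong : strongly_graded G.
Local Notation P := (pos_ring G).
Local Notation z2p := (@zero_to_pos R G).

Lemma coordinates (C : complex P) (B : nat) :
  (forall n : int, (B < `|n|)%N -> forall x : C n, x = 0) -> fg_free C ->
  exists (r : int -> nat)
    (psi : forall n, {linear C n -> {ffun 'I_(r n) -> (P^c)^o}}),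
    (forall n, bijective (psi n)) /\ forall n : int, (B < `|n|)%N -> r n = 0%N.
Proof.
move=> C0 Cfree.
have coord n : exists t : {r : nat & {linear C n -> {ffun 'I_r -> (P^c)^o}}},
    bijective (tagged t) /\ ((B < `|n|)%N -> tag t = 0%N).
  have [nB|Bn] := leqP `|n|%N B.
    have [r [phi /linear_inverse[psi [phiK psiK]]]] := Cfree n.
    by exists (existT _ r psi); split=> //; exists phi.
  (* Over the zero ring a zero module is free of every rank, so rank 0 is chosen explicitly outside
     the bounds. *)
  exists (existT _ 0%N (\0 : {linear C n -> {ffun 'I_0 -> (P^c)^o}})).
  split=> //=; exists (fun=> 0) => x /=; first by rewrite [RHS]C0.
  by apply/ffunP => -[].
have [t tP] := dep_choice coord.
exists (fun n => tag (t n)), (fun n => tagged (t n)).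
by split=> n; case: (tP n).
Qed.

Lemma frame_pos_col (M : lmodType P^c) k (psi : {linear M -> {ffun 'I_k -> (P^c)^o}}) :
  bijective psi -> frame (fun x => pos_col (psi x)).
Proof.
case=> phi psiK phiK; split=> [|x y /pos_col_inj/(can_inj psiK)//|x|v v0].
- exact/colinear_comp/pos_col_lin.
- exact: pos_colP.
- by have [x <-] := pos_col_surj v0; exists (phi x); rewrite phiK.
Qed.

Lemma fd_htpy (C : complex P) : finitely_dominated (restr_complex z2p C) ->
  exists (h : forall n, {linear restr z2p (C n) -> restr z2p (C (n + 1))})
    (g : forall n, C n -> C n),
  (forall n (x : C (n + 1)),
     x = cdiff C (n + 1) (h (n + 1) x) + h n (cdiff C n x) + g (n + 1) x) /\
  forall k (n : int) (X : C n -> 'cV[R]_k), frame X ->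
    exists q, forall x, mdeg_le G q (X (g n x)).
Proof.
move=> [E [_ Efree [i [r [_ _ [s sE]]]]]].
(* The sign turns [r i - 1 = d s + s d] into [1 = d h + h d + r i], with error term [g = r i]. *)
pose opp n : {linear restr z2p (C n) -> restr z2p (C (n + 1))} := \- s n.
exists opp, (fun n x => r n (i n x)); split=> [n x|k n X fX].
  have aux (V : zmodType) (u y v w : V) : u - y = v + w -> y = - v - w + u.
    by move=> uy; rewrite -opprD -uy opprB subrK.
  have xE : x = - cdiff C (n + 1) (s (n + 1) x) - s n (cdiff C n x) +
    r (n + 1) (i (n + 1) x) := aux (C (n + 1)) _ _ _ _ (sE n x).
  by rewrite {1}xE; congr (_ + _ + _); rewrite -linearN.
exact: finite_bound (i n) (r n) fX (Efree n).
Qed.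

Lemma Omega_plus_contraction (C : complex P) (B : nat) (r : int -> nat)
    (X : forall n, C n -> 'cV[R]_(r n)) (D : forall n : int, 'M[R]_(r n, r (n + 1))) :
  (forall n : int, (B < `|n|)%N -> r n = 0%N) ->
  (forall n, frame (@X n)) ->
  (forall n, mtpow G 0 (D n)) -> (forall n x, X n (cdiff C n x) = D n *m X (n + 1) x) ->
  finitely_dominated (restr_complex z2p C) ->
  exists (N : int) (S : forall n : int, 'M[R]_(r (n + 1), r n)),
    (forall n, mtpow G N (S n)) /\
    forall n, let A := D (n + 1) *m S (n + 1) + S n *m D n in
      mtpow G N A /\ Omega_plus G A.
Proof.
move=> rB XF D0 DX /fd_htpy[h [g [hg gX]]].
have g_bound n : exists q, forall x, mdeg_le G q (X n (g n x)).
  exact: gX (XF n).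
(* With [k = 2B + 2] the relation holds up to index [B], beyond which the matrices are empty. The
   choice [N = |e| + 1] then puts the error in degrees at most [-1]. *)
have [e eP] := approximate_contraction G_strong XF D0 DX hg g_bound rB (B + B + 2).
have [S [SN SE]] := eP (absz e).+1.
exists (absz e).+1%:Z, S; split=> // n; split.
  apply: mtpowD.
    by rewrite -[X in mtpow _ X]add0r; exact: mtpowM.
  by rewrite -[X in mtpow _ X]addr0; exact: mtpowM.
apply: Omega_plus_near1 => i j.
have [nB|Bn] := leP n (B + B + 2)%N%:Z; last first.
  by have := ltn_ord i; rewrite [X in (_ < X)%N]rB //; lia.
have [nB'|Bn'] := leP n ((B + B + 2)%N%:Z - B%:Z - 2); last first.
  by have := ltn_ord i; rewrite [X in (_ < X)%N]rB //; lia.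
by rewrite opprD addrA; apply: deg_leW (SE n nB' i j); lia.
Qed.

Lemma tpow_lift m (M : lmodType P^c) k (Y : M -> 'cV[R]_k) :
  colinear Y -> (forall x, mtpow G m (Y x)) ->
  exists g : {linear M -> {ffun 'I_k -> tpow G m}}, forall x, tpow_col (g x) = Y x.
Proof.
move=> Ylin Ym; apply: (linear_lift (@tpow_col_lin _ _ m k) Ylin).
  exact: tpow_col_inj.
by move=> x; apply: tpow_col_surj.
Qed.

Lemma inverting_makes_contractible (L : pzRingType) (lambda : {rmorphism P -> L}) :
  inverting (@Omega_plus_maps R G) lambda -> makes_fd_contractible lambda.
Proof.
move=> inv C [B C0] Cfree Cfd.
have [r [psi [psi_bij rB]]] := coordinates C0 Cfree.
pose X n (x : C n) : 'cV[R]_(r n) := pos_col (psi n x).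
have XF n : frame (@X n) by exact: frame_pos_col.
have Xlin n : colinear (@X n) by case: (XF n).
have Xpos n x : mtpow G 0 (X n x) by case: (XF n).
have Dex n : exists D : 'M[R]_(r n, r (n + 1)),
    mtpow G 0 D /\ forall x, X n (cdiff C n x) = D *m X (n + 1) x.
  by have [D D0 DE] := frame_matrix (cdiff C n) (XF (n + 1)) (XF n); exists D.
have [D DP] := dep_choice Dex.
have [N [S [SN AP]]] := Omega_plus_contraction rB XF (fun n => (DP n).1)
  (fun n => (DP n).2) Cfd.
pose A n := D (n + 1) *m S (n + 1) + S n *m D n.
(* The modules [T n], with the differentials [delta] given by the same matrices [D], form the
   shifted complex [t^-N C]. *)
pose T n : lmodType P^c := {ffun 'I_(r n) -> tpow G N}.
pose Z n : T n -> 'cV[R]_(r n) := @tpow_col _ _ N (r n).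
have Zlin n : colinear (@Z n) by exact: tpow_col_lin.
have Zinj n : injective (Z n) by exact: tpow_col_inj.
have sigma_ex n : exists g : {linear C n -> T (n + 1)},
    forall x, Z (n + 1) (g x) = S n *m X n x.
  apply: tpow_lift => [|x]; first exact: colinear_mul.
  by rewrite -[N]addr0; exact: mtpowM.
have [sigma sigmaE] := dep_choice sigma_ex.
have delta_ex n : exists g : {linear T (n + 1) -> T n},
    forall x, Z n (g x) = D n *m Z (n + 1) x.
  apply: tpow_lift => [|x]; first exact: colinear_mul.
  by rewrite -[N]add0r; apply: mtpowM; [case: (DP n) | exact: tpow_colP].
have [delta deltaE] := dep_choice delta_ex.
have phi_ex n : exists g : {linear C (n + 1) -> T (n + 1)},
    (forall x, Z (n + 1) (g x) = A n *m X (n + 1) x) /\ bijective (tens_map lambda g).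
  have [AN AO] := AP n.
  exists (mu AN \o psi (n + 1)); split=> [x|]; first exact: mu_col.
  have := bij_comp (inv _ _ _ (OmegaPlusMap AN AO)) (tens_map_bij lambda (psi_bij (n + 1))).
  by move=> /eq_bij; apply=> x; exact/esym/tens_map_comp.
have [phi phiP] := dep_choice phi_ex.
have inv_ex n := linear_inverse (phiP n).2.
have [theta thetaP] := dep_choice inv_ex.
have sum_phi n x : phi n x = delta (n + 1) (sigma (n + 1) x) + sigma n (cdiff C n x).
  apply: (Zinj (n + 1)); rewrite (Zlin (n + 1)).1.
  rewrite [LHS](phiP n).1 deltaE !sigmaE (DP n).2.
  by rewrite mulmxDl !mulmxA.
have chain_phi n x :
    phi n (cdiff C (n + 1) x) = delta (n + 1) (phi (n + 1) x).
  apply: (Zinj (n + 1)); rewrite [LHS](phiP n).1 [RHS]deltaE (phiP (n + 1)).1.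
  rewrite (DP (n + 1)).2 !mulmxA; congr (_ *m _).
  rewrite mulmxDl mulmxDr -!mulmxA.
  rewrite (frame_diffK XF (fun n => (DP n).2)).
  rewrite [X in _ = X + _]mulmxA (frame_diffK XF (fun n => (DP n).2)).
  by rewrite mul0mx !mulmx0 add0r addr0.
(* The contraction is the null-homotopy [sigma] of [phi] followed by the inverse of [phi]. It is
   checked after applying [phi], which commutes with the differentials. *)
exists (fun n => theta n \o tens_map lambda (sigma n)) => n x.
apply: (can_inj (thetaP n).1); rewrite [_ - _]subr0 linearD.
rewrite [X in _ = X + _](tens_map_square (chain_phi n)).
rewrite [X in _ = tens_map _ _ X + _](thetaP (n + 1)).2 [X in _ = _ + X](thetaP n).2.
rewrite (@tens_mapD _ _ _ _ _ (delta (n + 1) \o sigma (n + 1)) (sigma n \o cdiff C n)) //.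
by congr (_ + _); exact: tens_map_comp.
Qed.
End InvertingMakesContractible.

(** * Three-term complexes *)

Section FreeModules.
Variable K : pzRingType.

Lemma fg_free_iso (M N : lmodType K^c) (g : {linear M -> N}) :
  bijective g -> fg_free_mod M -> fg_free_mod N.
Proof. by move=> gb [n [phi phib]]; exists n, (g \o phi); exact: bij_comp. Qed.

Lemma fg_free_ffun (T : finType) : fg_free_mod {ffun T -> (K^c)^o}.
Proof.
pose e (x : {ffun 'I_#|T| -> (K^c)^o}) : {ffun T -> (K^c)^o} :=
  [ffun t => x (enum_rank t)].
have [phi phiE] : exists phi : {linear {ffun 'I_#|T| -> (K^c)^o} ->
    {ffun T -> (K^c)^o}}, phi =1 e.
  by apply: linear_of => a x y; apply/ffunP => t; rewrite !ffunE.
exists #|T|, phi; exists (fun y : {ffun T -> (K^c)^o} =>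
  [ffun j => y (enum_val j)]) => x.
  by rewrite phiE; apply/ffunP => j; rewrite !ffunE enum_valK.
by rewrite phiE; apply/ffunP => t; rewrite !ffunE enum_rankK.
Qed.

Lemma fg_free_pair (T U : finType) :
  fg_free_mod ({ffun T -> (K^c)^o} * {ffun U -> (K^c)^o})%type.
Proof.
pose e (x : {ffun T + U -> (K^c)^o}) : {ffun T -> (K^c)^o} * {ffun U -> (K^c)^o} :=
  ([ffun t => x (inl t)], [ffun u => x (inr u)]).
have [phi phiE] : exists phi : {linear {ffun T + U -> (K^c)^o} ->
    ({ffun T -> (K^c)^o} * {ffun U -> (K^c)^o})%type}, phi =1 e.
  by apply: linear_of => a x y; congr (_, _); apply/ffunP => t; rewrite !ffunE.
apply: (@fg_free_iso _ _ phi) (fg_free_ffun (T + U)%type); exists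
  (fun y : {ffun T -> (K^c)^o} * {ffun U -> (K^c)^o} =>
     [ffun t => match t with inl t => y.1 t | inr u => y.2 u end]) => x.
  by rewrite phiE; apply/ffunP => -[t|u]; rewrite !ffunE.
by rewrite phiE; case: x => x y; congr (_, _); apply/ffunP => t; rewrite !ffunE.
Qed.

End FreeModules.

Section ThreeTermComplex.
Variables (K : pzRingType) (M2 M1 M0 : lmodType K^c).
Variables (d2 : {linear M2 -> M1}) (d1 : {linear M1 -> M0}).
Hypothesis d1d2 : forall x, d1 (d2 x) = 0.

(** The zero module is encoded as functions on ['I_0], which makes it visibly free of rank 0. *)
Definition three_obj (n : int) : lmodType K^c :=
  match n with
  | Posz 0 => M0 | Posz 1 => M1 | Posz 2 => M2
  | _ => {ffun 'I_0 -> (K^c)^o}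
  end.

Definition three_diff (n : int) : {linear three_obj (n + 1) -> three_obj n} :=
  match n return {linear three_obj (n + 1) -> three_obj n} with
  | Posz 0 => d1 | Posz 1 => d2 | _ => \0
  end.

Fact three_diffK (n : int) (x : three_obj (n + 1 + 1)) :
  three_diff n (three_diff (n + 1) x) = 0.
Proof.
case: n x => [[|[|n]]|[|n]] x //=.
exact: linear0.
Qed.

Definition three_complex : complex K := Complex three_diffK.

Lemma three_bounded : bounded three_complex.
Proof. by exists 2 => -[[|[|[|n]]]|n] // _ x; apply/ffunP => -[]. Qed.

Lemma three_free : fg_free_mod M2 -> fg_free_mod M1 -> fg_free_mod M0 ->
  fg_free three_complex.
Proof.
by move=> f2 f1 f0 [[|[|[|n]]]|n] //=; exact: fg_free_ffun.
Qed.

End ThreeTermComplex.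

(** * A map with projective target as a summand of a complex of free modules *)

Section Splitting.
Variables (K P : pzRingType) (e : {rmorphism K -> P}).

(* [sigma] is split injective over [K] and its cokernel is a retract of the
   finitely generated free [K]-module with basis [T]. *)
Definition fd_split (U V : lmodType P^c) (sigma : {linear U -> V}) : Prop :=
  exists (T : finType) (rho : {linear restr e V -> restr e U})
    (alpha : {linear restr e V -> {ffun T -> (K^c)^o}})
    (beta : {linear {ffun T -> (K^c)^o} -> restr e V}),
  [/\ forall x, rho (sigma x) = x, forall x, alpha (sigma x) = 0 &
      forall y : V, beta (alpha y) = y - sigma (rho y)].

Variables (U V U' F : lmodType P^c).
Variables (sigma : {linear U -> V}) (sigma' : {linear U' -> V}).
Variables (i : {linear V -> F}) (p : {linear F -> V}).
Hypothesis ip : forall x, p (i x) = x.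

(** Writing [F] as the sum of [V] and the kernel [Q] of [p], the resulting complex is the direct sum
    of [sigma] in degrees 1 and 0, [sigma'] in degrees 2 and 1, and the identity of [Q] in degrees 1
    and 0. *)
Lemma three_data : exists (d2 : {linear U' -> (F * U)%type})
    (d1 : {linear (F * U)%type -> F}),
  (forall x, d2 x = (i (sigma' x), 0)) /\
  (forall y, d1 y = y.1 - i (p y.1) + i (sigma y.2)).
Proof.
pose d1 : {linear (F * U)%type -> F} := (fst \- (i \o (p \o fst))) \+ (i \o (sigma \o snd)).
have [d2 d2E] : exists d2 : {linear U' -> (F * U)%type},
    d2 =1 fun x => (i (sigma' x), 0).
  apply: linear_of => a x y; rewrite !linearP.
  by congr (_, _); rewrite /= scaler0 addr0.
by exists d2, d1.
Qed.

Lemma restr_pair (W : lmodType K^c) (g : {linear W -> restr e F})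
    (h : {linear W -> restr e U}) :
  exists k : {linear W -> restr e (F * U)%type}, forall x, k x = (g x, h x).
Proof. by apply: linear_of => a x y; rewrite !linearP. Qed.

Variables (d2 : {linear U' -> (F * U)%type}) (d1 : {linear (F * U)%type -> F}).
Hypothesis d2E : forall x, d2 x = (i (sigma' x), 0).
Hypothesis d1E : forall y, d1 y = y.1 - i (p y.1) + i (sigma y.2).

Lemma three_d1d2 x : d1 (d2 x) = 0.
Proof. by rewrite d1E d2E /= ip subrr add0r !linear0. Qed.

Lemma three_pd1 y : p (d1 y) = sigma y.2.
Proof. by rewrite d1E linearD linearB !ip subrr add0r. Qed.

(** Over [K] the complex is equivalent to the cokernels of [sigma] in degree 0 and [sigma'] in
    degree 1. It is therefore dominated by free modules on [T] and [T'] with zero differential. *)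
Lemma three_fd : fd_split sigma -> fd_split sigma' ->
  finitely_dominated (restr_complex e (three_complex three_d1d2)).
Proof.
move=> [T [rho [alpha [beta [rhoK alphaK betaE]]]]].
move=> [T' [rho' [alpha' [beta' [rhoK' alphaK' betaE']]]]].
pose D1 : lmodType K^c := {ffun T' -> (K^c)^o}.
pose D0 : lmodType K^c := {ffun T -> (K^c)^o}.
pose D2 : lmodType K^c := {ffun 'I_0 -> (K^c)^o}.
pose F' : lmodType K^c := restr e F.
pose FU : lmodType K^c := restr e (F * U)%type.
pose pe : {linear F' -> restr e V} := restr_map e p.
pose ie : {linear restr e V -> F'} := restr_map e i.
pose fste : {linear FU -> F'} := restr_map e fst.
pose i1 : {linear FU -> D1} := alpha' \o (pe \o fste).
pose i0 : {linear F' -> D0} := alpha \o pe.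
pose r0 : {linear D0 -> F'} := ie \o beta.
have [r1 r1E] := restr_pair (ie \o beta') \0.
(* Up to sign, [s0] contracts the identity of [Q] and inverts [sigma] by [rho]; [s1] does the same
   for [sigma']. *)
have [s0 s0E] := restr_pair ((ie \o pe) \- idfun) (\- (rho \o pe)).
pose s1 : {linear FU -> restr e U'} := \- (rho' \o (pe \o fste)).
have d0 : forall x : D2, (\0 : {linear D1 -> D0}) ((\0 : {linear D2 -> D1}) x) = 0.
  by [].
exists (three_complex d0); split.
- exact: three_bounded.
- by apply: three_free; exact: fg_free_ffun.
pose C := restr_complex e (three_complex three_d1d2).
pose D := three_complex d0.
pose I (n : int) : {linear C n -> D n} :=
  match n return {linear C n -> D n} with
  | Posz 0 => i0 | Posz 1 => i1 | _ => \0
  end.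
pose Rr (n : int) : {linear D n -> C n} :=
  match n return {linear D n -> C n} with
  | Posz 0 => r0 | Posz 1 => r1 | _ => \0
  end.
pose s (n : int) : {linear C n -> C (n + 1)} :=
  match n return {linear C n -> C (n + 1)} with
  | Posz 0 => s0 | Posz 1 => s1 | _ => \0
  end.
exists I, Rr; split.
- move=> [[|[|[|n]]]|[|n]] x //=; rewrite /restr_map_fun.
    by rewrite three_pd1 alphaK.
  by rewrite d2E /= ip alphaK'.
- move=> [[|[|[|n]]]|[|n]] x //=; rewrite /restr_map_fun.
    by rewrite r1E /= d1E /= /restr_map_fun ip subrr add0r !linear0.
  by rewrite !linear0.
- exists s => -[[|[|[|n]]]|[|n]] x /=; rewrite /restr_map_fun; last by apply/ffunP => -[].
  + case: x => y u; rewrite r1E s0E d2E /= /restr_map_fun three_pd1 d1E rhoK.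
    rewrite betaE'; congr (_, _); rewrite /= linearB linearN linearN /=.
    by rewrite opprD [_ + (_ - i (sigma u))]addrCA subrr addr0 opprB addrA [- _ + _]addrC.
  + by rewrite d2E /= ip rhoK'.
  + by apply/ffunP => -[].
  + by apply/ffunP => -[].
  + rewrite betaE addr0 d1E s0E /= /restr_map_fun [p (_ - _)]linearB ip subrr linear0 subr0.
    by rewrite linearB !linearN addrAC.
Qed.
(** Contractibility passes to the summand [sigma]: the component of the contraction from [V] to [U]
    is a two-sided inverse, because [d2] has no component in [U] and [p d1 = sigma snd]. *)
Lemma three_contractible_bij (S : pzRingType) (f : {rmorphism P -> S}) :
  contractible (tens_complex f (three_complex three_d1d2)) ->
  bijective (tens_map f sigma).
Proof.
case=> s sE; pose s0 : {linear tensor f F -> tensor f (F * U)%type} := s 0.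
pose s1 : {linear tensor f (F * U)%type -> tensor f U'} := s 1.
have s0E (x : tensor f F) : tens_map f d1 (s0 x) = x.
  have d0 : cdiff (tens_complex f (three_complex three_d1d2)) (Negz 0) x = 0.
    exact: (@tens_map0 _ _ f _ _ (three_diff d2 d1 (Negz 0))).
  have xE : x - 0 = tens_map f d1 (s0 x) +
      s (Negz 0) (cdiff (tens_complex f (three_complex three_d1d2)) (Negz 0) x).
    exact: sE (Negz 0) x.
  by rewrite d0 subr0 linear0 addr0 in xE.
have s1E (x : tensor f (F * U)%type) : s0 (tens_map f d1 x) = x - tens_map f d2 (s1 x).
  have xE : x - 0 = tens_map f d2 (s1 x) + s0 (tens_map f d1 x) := sE 0 x.
  by rewrite subr0 in xE; rewrite {2}xE addrC addKr.
have [j jE] : exists j : {linear U -> (F * U)%type}, forall u, j u = (0, u).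
  by apply: linear_of => a u v; congr (_, _); rewrite /= scaler0 addr0.
exists (fun z => tens_map f snd (s0 (tens_map f i z))) => z.
  rewrite (@tens_map_square _ _ _ _ _ _ _ i sigma d1 j) => [|u]; last first.
    by rewrite d1E jE /= !linear0 addr0 add0r.
  rewrite s1E linearB /= -(@tens_map_comp _ _ f _ _ _ snd j idfun) => [|u]; last first.
    by rewrite jE.
  rewrite tens_map_id // -(@tens_map_comp _ _ f _ _ _ snd d2 \0) => [|u]; last first.
    by rewrite d2E.
  by rewrite tens_map0 // subr0.
rewrite (@tens_map_square _ _ _ _ _ _ _ sigma snd p d1) => [|y]; last first.
  by rewrite three_pd1.
rewrite s0E -(@tens_map_comp _ _ f _ _ _ p i idfun) => [|v]; last by rewrite ip.
exact: tens_map_id.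
Qed.

End Splitting.

(** * Inverting [Omega_plus] *)

Section ContractibleMakesInverting.
Variables (R : pzRingType) (G : grading R).
Hypothesis G_strong : strongly_graded G.
Local Notation P := (pos_ring G).
Local Notation z2p := (@zero_to_pos R G).

(** If [rho] truncates [A^-1 y], the remainder [y - A rho y] is [A] times the negative part of
    [A^-1 y]. Its degrees lie between [-m] and [d - 1], where [d] bounds [A], so [window_coord]
    supplies [alpha] and [beta]. *)
Lemma mu_fd_split k (A : 'M[R]_k) m (Am : suitable G A m) :
  Omega_plus G A -> fd_split z2p (mu Am).
Proof.
move=> [B [AB BA]]; pose U : lmodType P^c := {ffun 'I_k -> (P^c)^o}.
pose V : lmodType P^c := {ffun 'I_k -> tpow G m}.
pose lau p q (M : 'M[R]_(p, q)) := map_mx (laurent_of G) M.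
have [tr trE] := choice (@laurent_trunc R G).
have trD a b : tr (a + b) = tr a + tr b.
  apply: val_inj; apply: (@hcomp_inj _ G) => l; rewrite [RHS]hcompD !trE lcoefD.
  by case: ifP; rewrite ?addr0.
have trM a z : tr (a * laurent_of G (zero_val z)) = tr a * z2p z.
  apply: val_inj; apply: (@hcomp_inj _ G) => l; rewrite [RHS]hcompM0; last exact: (valP z).
  by rewrite !trE laurentM0; [case: ifP; rewrite ?mul0r | exact: (valP z)].
have trK (x : P) : tr (laurent_of G (pos_val x)) = x.
  apply: val_inj; apply: (@hcomp_inj _ G) => l; rewrite trE.
  by case: leP => // l0; have /tpow_predP -> := valP x; rewrite ?oppr0.
pose w (y : V) := B *m lau _ _ (tpow_col y).
have wD x y : w (x + y) = w x + w y.
  by rewrite /w (tpow_col_lin G m k).1 /lau map_mxD mulmxDr.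
have wM (a : zero_ring G) y : w ((z2p a : P^c) *: y) =
    w y *m (laurent_of G (zero_val a))%:M.
  by rewrite /w (tpow_col_lin G m k).2 /lau map_mxM map_scalar_mx mulmxA.
pose rho0 (y : V) : U := [ffun j => tr (w y j 0)].
have [rho rhoE] : exists rho : {linear restr z2p V -> restr z2p U}, rho =1 rho0.
  apply: linear_of => a x y; rewrite /rho0; apply/ffunP => j; rewrite ffunE.
  rewrite -[_ *: _]/((z2p a : P^c) *: (x : V)) wD mxE trD wM.
  rewrite mulmx_scalar1 trM.
  by rewrite !ffunE.
have rhoK x : rho (mu Am x) = x.
  rewrite rhoE; apply/ffunP => j; rewrite ffunE /w mu_col /lau map_mxM mulmxA BA mul1mx.
  by rewrite !mxE trK.
have [d Ad] := mdeg_le_ex G A.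
have [rem remE] : exists rem : V -> V, forall y, rem y = y - mu Am (rho y).
  by exists (fun y => y - mu Am (rho y)).
have rem_deg y : mdeg_le G (d - 1) (tpow_col (rem y)).
  have -> : tpow_col (rem y) = tpow_col y - A *m pos_col (rho y).
    by rewrite remE (colinearB (tpow_col_lin G m k)) mu_col.
  suff : mxdeg_le (d - 1) (lau _ _ A *m (w y - lau _ _ (pos_col (rho y)))).
    rewrite mulmxBr {1}/w mulmxA AB mul1mx /lau -map_mxM -map_mxB => h i j.
    by have := h i j; rewrite mxE.
  apply: mxdeg_leM => [i j|i j l l0]; first by rewrite mxE; exact: Ad.
  rewrite (ord1 j) !mxE rhoE ffunE -[LHS]/(_ - hcomp G _ _) trE.
  by case: leP => [_|]; [rewrite /w mxE; exact: subrr | lia].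
(* Starting at [-m], a window of length [|d + m|] reaches at least degree [d - 1]. *)
have [T [a [c [aG cB cM acE]]]] := window_coord G_strong (- m) (absz (d + m)).
rewrite opprK in aG.
have c0 t : c t 0 = 0 by rewrite -[X in c _ X](subrr 0) cB subrr.
exists (T * 'I_k)%type, rho.
have rem_lin (z : zero_ring G) x y :
    rem ((z2p z : P^c) *: x + y) = (z2p z : P^c) *: rem x + rem y.
  rewrite !remE -[rho _]/(rho ((z : (zero_ring G)^c) *: (x : restr z2p V) + y)).
  rewrite linearP -[_ *: rho x]/((z2p z : P^c) *: (rho x : U)) linearP.
  by rewrite scalerBr opprD addrACA.
pose alpha0 (y : V) : {ffun T * 'I_k -> ((zero_ring G)^c)^o} :=
  [ffun ti => c ti.1 (tpow_val (rem y ti.2))].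
have [alpha alphaE] : exists alpha : {linear restr z2p V ->
    {ffun T * 'I_k -> ((zero_ring G)^c)^o}}, alpha =1 alpha0.
  apply: linear_of => z x y; apply/ffunP => ti; rewrite !ffunE.
  rewrite -[LHS]/(c ti.1 (tpow_val (rem ((z2p z : P^c) *: (x : V) + y) ti.2))).
  rewrite rem_lin ffunE ffunE.
  have cD u v : c ti.1 (u + v) = c ti.1 u + c ti.1 v.
    have cN v' : c ti.1 (- v') = - c ti.1 v' by rewrite -[- v']sub0r cB c0 sub0r.
    by rewrite -[v in LHS]opprK cB cN opprK.
  by rewrite [LHS]cD [X in X + _]cM.
pose beta0 (g : {ffun T * 'I_k -> ((zero_ring G)^c)^o}) : V :=
  [ffun j => \sum_t (z2p (g (t, j) : zero_ring G) : P^c) *: TPow (aG t)].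
have [beta betaE] : exists beta : {linear {ffun T * 'I_k -> ((zero_ring G)^c)^o} ->
    restr z2p V}, beta =1 beta0.
  apply: linear_of => z x y; apply/ffunP => j.
  rewrite -[RHS]/(((z2p z : P^c) *: beta0 x + beta0 y) j) !ffunE scaler_sumr -big_split.
  apply: eq_bigr => t _ /=; rewrite !ffunE scalerA -scalerDl; congr (_ *: _).
  by apply: val_inj.
exists alpha, beta; split=> //.
  move=> x; rewrite alphaE; apply/ffunP => ti; rewrite !ffunE remE rhoK subrr ffunE.
  exact: c0.
move=> y; rewrite betaE alphaE -remE; apply/ffunP => j; rewrite ffunE.
apply: val_inj; rewrite raddf_sum /=.
under eq_bigr do rewrite ffunE /=.
rewrite acE window_sum //; first by rewrite opprK; exact: valP.
have := rem_deg y j 0; rewrite mxE; apply: deg_leW; lia.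
Qed.

(** The [a_q] in [R_-m] generate [t^-m P] over [P], with dual coordinates the left multiplications
    by [b_q] in [R_m]. *)
Lemma tpow_retract k (m : int) : exists (T : finType)
    (i : {linear {ffun 'I_k -> tpow G m} -> {ffun T -> (P^c)^o}})
    (p : {linear {ffun T -> (P^c)^o} -> {ffun 'I_k -> tpow G m}}),
  forall x, p (i x) = x.
Proof.
have [l [a [b [aG bG ab1]]]] := unit_decomp G_strong (- m).
have am q : a q \in tpow_pred G m by apply: tpow_homog (aG q).
have bm q (x : tpow G m) : b q * tpow_val x \in pos_pred G.
  rewrite /pos_pred -(addNr m); apply: tpow_mul (valP x).
  by apply: tpow_homog (bG q); rewrite opprK.
pose i0 (v : {ffun 'I_k -> tpow G m}) : {ffun 'I_l * 'I_k -> (P^c)^o} :=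
  [ffun qj => PosRing (bm qj.1 (v qj.2)) : (P^c)^o].
have [i iE] : exists i : {linear {ffun 'I_k -> tpow G m} ->
    {ffun 'I_l * 'I_k -> (P^c)^o}}, i =1 i0.
  apply: linear_of => c x y; apply/ffunP => qj; rewrite !ffunE; apply: val_inj.
  by rewrite /= mulrDr mulrA.
pose p0 (y : {ffun 'I_l * 'I_k -> (P^c)^o}) : {ffun 'I_k -> tpow G m} :=
  [ffun j => \sum_q (y (q, j) : P^c) *: TPow (am q)].
have [p pE] : exists p : {linear {ffun 'I_l * 'I_k -> (P^c)^o} ->
    {ffun 'I_k -> tpow G m}}, p =1 p0.
  apply: linear_of => c x y; apply/ffunP => j; rewrite !ffunE scaler_sumr -big_split.
  by apply: eq_bigr => q _ /=; rewrite !ffunE scalerA -scalerDl.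
exists ('I_l * 'I_k)%type, i, p => x; rewrite pE iE; apply/ffunP => j; rewrite ffunE.
apply: val_inj; rewrite raddf_sum /=.
under eq_bigr do rewrite ffunE /= mulrA.
by rewrite -mulr_suml ab1 mul1r.
Qed.

Lemma suitable1 k m : 0 <= m -> suitable G (1%:M : 'M[R]_k) m.
Proof. by move=> m0; have h := @mtpow1 R G k; exact: mtpowW h. Qed.

Lemma Omega_plus1 k : Omega_plus G (1%:M : 'M[R]_k).
Proof. by exists 1%:M; rewrite map_mx1 mulmx1. Qed.

Lemma pos_lift (M : lmodType P^c) k (Y : M -> 'cV[R]_k) :
  colinear Y -> (forall x, mtpow G 0 (Y x)) ->
  exists g : {linear M -> {ffun 'I_k -> (P^c)^o}}, forall x, pos_col (g x) = Y x.
Proof.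
move=> Ylin Y0; apply: (linear_lift (@pos_col_lin _ _ k) Ylin).
  exact: pos_col_inj.
by move=> x; apply: pos_col_surj.
Qed.

Section Inverting.
Variables (S : pzRingType) (f : {rmorphism P -> S}).
Hypothesis f_contr : makes_fd_contractible f.

Lemma mu_bij_nonneg k (A : 'M[R]_k) m (Am : suitable G A m) :
  0 <= m -> Omega_plus G A -> bijective (tens_map f (mu Am)).
Proof.
move=> m0 AO; have [T [i [p ip]]] := tpow_retract k m.
(* For [m >= 0] the inclusion of [P^k] is a map to the same projective module as [mu Am], and it
   comes from the identity matrix in [Omega_plus]. *)
pose sigma' := mu (suitable1 (k := k) m0).
have [d2 [d1 [d2E d1E]]] := three_data (mu Am) sigma' i p.
apply: (@three_contractible_bij _ _ _ _ _ _ _ _ _ ip _ _ d2E d1E); apply: f_contr.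
- exact: three_bounded.
- by apply: three_free; [| exact: fg_free_pair |]; exact: fg_free_ffun.
- by apply: three_fd; apply: mu_fd_split => //; exact: Omega_plus1.
Qed.

Lemma tens_map_sum_id (M N : lmodType P^c) (l : nat) (g : 'I_l -> {linear N -> M})
    (h : 'I_l -> {linear M -> N}) : (forall x, \sum_q g q (h q x) = x) ->
  forall x, \sum_q tens_map f (g q) (tens_map f (h q) x) = x.
Proof.
move=> ghE; elim/tensor_ind => [|x y IHx IHy|x s].
- by apply: big1 => q _; rewrite !linear0.
- by rewrite -[in RHS]IHx -[in RHS]IHy -big_split; apply: eq_bigr => q _; rewrite !linearD.
under eq_bigr do rewrite !tens_map_pure.
rewrite -[in RHS](ghE x); symmetry; apply: (big_morph (fun x => pure_tensor f x s)).
  by move=> ? ?; exact: pure_tensorD.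
by apply/tens_sumP; exact: TensZero.
Qed.

(* Inclusions into [P] are inverted because [j : P -> t^m P] is: writing
   [1 = sum_q a_q b_q] with [a_q] of degree [-m] and [b_q] of degree [m], the
   inverse is the sum of the composites [a_q j^-1 b_q]. *)
Lemma tpow_incl_bij k m (tau : {linear {ffun 'I_k -> tpow G m} -> {ffun 'I_k -> (P^c)^o}}) :
  m <= 0 -> (forall x, pos_col (tau x) = tpow_col x) -> bijective (tens_map f tau).
Proof.
move=> m0 tauE; have Nm0 : 0 <= - m by rewrite oppr_ge0.
have [l [a [b [aG bG ab1]]]] := unit_decomp G_strong (- m); rewrite opprK in bG.
have am q : a q \in tpow_pred G m by apply: tpow_homog (aG q).
have bm q : b q \in tpow_pred G (- m) by apply: tpow_homog (bG q); rewrite opprK.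
pose j := mu (suitable1 (k := k) Nm0).
have jE x : tpow_col (j x) = pos_col x by rewrite mu_col mul1mx.
have j_bij : bijective (tens_map f j) := mu_bij_nonneg _ Nm0 (Omega_plus1 k).
have [j' [jK j'K]] := linear_inverse j_bij.
have beta_ex q : exists g : {linear {ffun 'I_k -> (P^c)^o} -> {ffun 'I_k -> tpow G (- m)}},
    forall x, tpow_col (g x) = (b q)%:M *m pos_col x.
  apply: tpow_lift => [|x]; first exact/colinear_mul/pos_col_lin.
  by rewrite -[- m]addr0; apply: mtpowM; [exact: mtpow_scalar | exact: pos_colP].
have [beta betaE] := dep_choice beta_ex.
(* [beta] and [beta'] are the same multiplication by [b_q] with different sources and targets, so
   [beta tau = j beta']; likewise [tau alpha = alpha' j] below. *)
have beta'_ex q : exists g : {linear {ffun 'I_k -> tpow G m} -> {ffun 'I_k -> (P^c)^o}},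
    forall x, pos_col (g x) = (b q)%:M *m tpow_col x.
  apply: pos_lift => [|x]; first exact/colinear_mul/tpow_col_lin.
  by rewrite -(addNr m); apply: mtpowM; [exact: mtpow_scalar | exact: tpow_colP].
have [beta' beta'E] := dep_choice beta'_ex.
have alpha_ex q : exists g : {linear {ffun 'I_k -> (P^c)^o} -> {ffun 'I_k -> tpow G m}},
    forall x, tpow_col (g x) = (a q)%:M *m pos_col x.
  apply: tpow_lift => [|x]; first exact/colinear_mul/pos_col_lin.
  by rewrite -[m]addr0; apply: mtpowM; [exact: mtpow_scalar | exact: pos_colP].
have [alpha alphaE] := dep_choice alpha_ex.
have alpha'_ex q : exists g : {linear {ffun 'I_k -> tpow G (- m)} ->
      {ffun 'I_k -> (P^c)^o}},
    forall x, pos_col (g x) = (a q)%:M *m tpow_col x.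
  apply: pos_lift => [|x]; first exact/colinear_mul/tpow_col_lin.
  by rewrite -(addrN m); apply: mtpowM; [exact: mtpow_scalar | exact: tpow_colP].
have [alpha' alpha'E] := dep_choice alpha'_ex.
have abE v : \sum_q (a q)%:M *m ((b q)%:M *m v) = v :> 'cV[R]_k.
  under eq_bigr do rewrite mulmxA -scalar_mxM.
  by rewrite -mulmx_suml -raddf_sum ab1 mul1mx.
exists (fun x => \sum_q tens_map f (alpha q) (j' (tens_map f (beta q) x))) => x.
  rewrite -[RHS](@tens_map_sum_id _ _ _ alpha beta') => [|y]; last first.
    apply: tpow_col_inj; rewrite (colinear_sum (@tpow_col_lin _ _ _ _)).
    by under eq_bigr do rewrite alphaE beta'E; rewrite abE.
  apply: eq_bigr => q _; congr (tens_map f _ _).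
  rewrite (@tens_map_square _ _ _ _ _ _ _ (beta q) tau j (beta' q)) ?jK // => y.
  by apply: tpow_col_inj; rewrite betaE jE tauE beta'E.
rewrite linear_sum -[RHS](@tens_map_sum_id _ _ _ alpha' beta) => [|y]; last first.
  apply: pos_col_inj; rewrite (colinear_sum (@pos_col_lin _ _ _)).
  by under eq_bigr do rewrite alpha'E betaE; rewrite abE.
apply: eq_bigr => q _.
rewrite (@tens_map_square _ _ _ _ _ _ _ tau (alpha q) (alpha' q) j) ?j'K // => y.
by apply: pos_col_inj; rewrite tauE alphaE alpha'E jE.
Qed.

(** For [m < 0] the map [mu A 0] factors as [mu A m] followed by the inclusion [tau] and the
    identification [kappa]. All the other maps become invertible, hence so does [mu A m]. *)
Lemma contractible_makes_inverting : inverting (@Omega_plus_maps R G) f.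
Proof.
move=> M N _ [k A m Am AO]; have [m0|/ltW m0] := leP 0 m; first exact: mu_bij_nonneg.
have A0 : suitable G A 0 by move=> i j; exact: tpowW (Am i j).
have [tau tauE] : exists tau : {linear {ffun 'I_k -> tpow G m} ->
    {ffun 'I_k -> (P^c)^o}}, forall x, pos_col (tau x) = tpow_col x.
  by apply: pos_lift => [|x]; [exact: tpow_col_lin | apply: mtpowW (tpow_colP x)].
(* [kappa] identifies [P^k] with its copy whose entries have type [tpow G 0]. *)
pose kappa := mu (suitable1 (k := k) (lexx 0)).
have kt_bij : bijective (tens_map f kappa \o tens_map f tau).
  apply: bij_comp (tpow_incl_bij m0 tauE).
  by apply: mu_bij_nonneg (lexx 0) (Omega_plus1 k).
have ktm x : tens_map f (mu A0) x =
    tens_map f kappa (tens_map f tau (tens_map f (mu Am) x)).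
  rewrite -(@tens_map_comp _ _ f _ _ _ kappa tau (kappa \o tau)) //.
  apply: tens_map_comp => y; apply: tpow_col_inj.
  by rewrite /= !mu_col mul1mx tauE mu_col.
have [inv ktK invK] := kt_bij.
have : bijective (inv \o tens_map f (mu A0)).
  by apply: bij_comp; [exists (tens_map f kappa \o tens_map f tau) | exact: mu_bij_nonneg].
by move=> /eq_bij; apply => x; rewrite /= ktm; exact: ktK.
Qed.
End Inverting.
End ContractibleMakesInverting.

Theorem theorem10p7 (R : pzRingType) (G : grading R)
    (G_strong : strongly_graded G)
    (L : pzRingType) (lambda : {rmorphism pos_ring G -> L})
    (lambda_loc : is_localisation (@Omega_plus_maps R G) lambda) :
  makes_fd_contractible lambda /\
  forall (S : pzRingType) (f : {rmorphism pos_ring G -> S}),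
    makes_fd_contractible f ->
    exists eta : {rmorphism L -> S},
      f =1 eta \o lambda /\
      forall eta' : {rmorphism L -> S}, f =1 eta' \o lambda -> eta' =1 eta.
Proof.
case: lambda_loc => inv univ; split; first exact: inverting_makes_contractible.
by move=> S f fc; apply: univ; exact: contractible_makes_inverting.
Qed.
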